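(* Let $n\ge 6$ and $d\in\{3,\dots,\lfloor n/2\rfloor\}$. Then $$\mathring\mu_n(d\mid d-1)_1\le\frac{2d^2}{d+1}.$$
   Context: $\mathbb{R}^n$ and $\Lambda^2(\mathbb{R}^n)$ carry their canonical Euclidean norms. **Rational subspaces.** A linear subspace $B$ of $\mathbb{R}^n$ is rational if it has a basis of vectors with rational coordinates; $\mathfrak{R}_n(e)$ is the set of rational subspaces of $\mathbb{R}^n$ of dimension $e$. **Height.** For $B\in\mathfrak{R}_n(e)$, the Plücker coordinates of $B$ are the $\binom{n}{e}$ minors of size $e\times e$ of an $n\times e$ matrix whose columns form a basis of $B$ (well defined up to a nonzero scalar); choosing a representative $\Xi$ with integer coordinates with gcd $1$, set $H(B)=\|\Xi\|$ (Euclidean norm). **Angles.** For nonzero $X,Y\in\mathbb{R}^n$ let $\psi(X,Y)=\|X\wedge Y\|/(\|X\|\,\|Y\|)$ (sine of the angle). For subspaces $A,B$ of dimensions $d,e\ge 1$ and $t=\min(d,e)$, define $\psi_1(A,B),\dots,\psi_t(A,B)$ recursively: $\psi_1(A,B)=\min\psi(X,Y)$ over $X\in A\setminus\{0\}$, $Y\in B\setminus\{0\}$, attained at unit vectors $X_1,Y_1$; given $(X_1,Y_1),\dots,(X_j,Y_j)$, $\psi_{j+1}(A,B)=\min\psi(X,Y)$ over nonzero $X\in A$ orthogonal to $X_1,\dots,X_j$ and nonzero $Y\in B$ orthogonal to $Y_1,\dots,Y_j$, attained at unit vectors $X_{j+1},Y_{j+1}$. (These numbers do not depend on the choices.) **Irrationality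 and exponents.** Let $d,e\in\{1,\dots,n-1\}$ with $d+e\le n$ and $1\le j\le\min(d,e)$. $\mathfrak{I}_n(d,e)_j$ is the set of $d$-dimensional subspaces $A$ of $\mathbb{R}^n$ with $\dim(A\cap B)<j$ for all $B\in\mathfrak{R}_n(e)$. For $A\in\mathfrak{I}_n(d,e)_j$, $\mu_n(A\mid e)_j\in(0,+\infty]$ is the supremum of the $\beta>0$ such that $\psi_j(A,B)\le H(B)^{-\beta}$ for infinitely many $B\in\mathfrak{R}_n(e)$. Finally $\mathring\mu_n(d\mid e)_j=\inf_{A\in\mathfrak{I}_n(d,e)_j}\mu_n(A\mid e)_j$. *)

(* Defs.v *)
From HB Require Import structures.
From mathcomp Require Import all_boot all_order all_algebra.
From mathcomp Require Import all_classical all_reals all_analysis.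

Set Implicit Arguments.
Unset Strict Implicit.
Unset Printing Implicit Defensive.

Import Order.TTheory GRing.Theory Num.Theory.
Local Open Scope classical_set_scope.
Local Open Scope ring_scope.

(* The vectors of R^n are the columns 'cV[R]_n and its linear subspaces are
   the elements of {vspace 'cV[R]_n}, on which Leibniz equality is equality of
   subspaces. The library's norm on matrices is the sup norm, so the Euclidean
   norm is defined here, for any finite family of coordinates. *)

Section Euclidean.
Variable R : realType.

Definition enorm (I : finType) (x : I -> R) : R :=
  Num.sqrt (\sum_i x i ^+ 2).

Definition vnorm n (X : 'cV[R]_n) : R := enorm (fun i => X i 0).

Definition dot n (X Y : 'cV[R]_n) : R := \sum_i X i 0 * Y i 0.

(* Coordinates of X /\ Y in the orthonormal basis e_i /\ e_j, i < j, of the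
   second exterior power. *)
Definition wedge n (X Y : 'cV[R]_n)
    (p : {p : 'I_n * 'I_n | (p.1 < p.2)%N}) : R :=
  let: (i, j) := val p in X i 0 * Y j 0 - X j 0 * Y i 0.

Definition psi n (X Y : 'cV[R]_n) : R :=
  enorm (wedge X Y) / (vnorm X * vnorm Y).

End Euclidean.

Section Rational.
Variable R : realType.

Definition rational_space n (e : nat) : set {vspace 'cV[R]_n} :=
  [set B | exists b : e.-tuple 'cV[rat]_n,
     basis_of B [seq map_mx ratr X | X <- b]].

(* The e-subsets of the rows, listed in increasing order. *)
Definition row_choice n e :=
  {f : {ffun 'I_e -> 'I_n} |
    [forall i : 'I_e, forall j : 'I_e, (i < j)%N ==> (f i < f j)%N]}.

Definition minor n e (M : 'M[R]_(n, e)) (f : row_choice n e) : R :=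
  \det (rowsub (fun i => val f i) M).

Definition plucker n e (B : {vspace 'cV[R]_n}) (x : row_choice n e -> R) :=
  exists2 M : 'M[R]_(n, e), basis_of B [seq col j M | j : 'I_e] &
  exists2 c : R, c != 0 & forall f, x f = c * minor M f.

Definition primitive_plucker n e (B : {vspace 'cV[R]_n})
    (Xi : row_choice n e -> int) :=
  plucker B (fun f => (Xi f)%:~R) /\ \big[gcdn/0%N]_f `|Xi f|%N = 1%N.

(* If B is rational, its primitive Plucker vector exists and is unique up to
   sign, so the set below is a singleton; otherwise it is empty. *)
Definition height n (B : {vspace 'cV[R]_n}) : R :=
  xget 0 [set h | exists2 Xi : row_choice n (\dim B) -> int,
    primitive_plucker B Xi & h = enorm (fun f => (Xi f)%:~R : R)].

End Rational.

Section Angles.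
Variables (R : realType) (n : nat).
Implicit Types (A B : {vspace 'cV[R]_n}) (s : seq ('cV[R]_n * 'cV[R]_n)).

Definition admissible A B s : set ('cV[R]_n * 'cV[R]_n) :=
  [set p | [/\ p.1 \in A, p.1 != 0, p.2 \in B, p.2 != 0 &
     {in s, forall q, dot p.1 q.1 = 0 /\ dot p.2 q.2 = 0}]].

(* This infimum is a minimum whenever there is an admissible pair: psi is
   invariant under scaling and the unit spheres are compact. *)
Definition min_psi A B s : R :=
  inf [set psi p.1 p.2 | p in admissible A B s].

Definition unit_minimizer A B s : set ('cV[R]_n * 'cV[R]_n) :=
  [set p | [/\ admissible A B s p, vnorm p.1 = 1, vnorm p.2 = 1 &
     psi p.1 p.2 = min_psi A B s]].

Fixpoint minimizers A B k : seq ('cV[R]_n * 'cV[R]_n) :=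
  if k is k'.+1 then
    let s := minimizers A B k' in rcons s (xget (0, 0) (unit_minimizer A B s))
  else [::].

(* psi_j(A, B), for 1 <= j <= min(dim A, dim B); other values of j are
   meaningless. *)
Definition psi_space A B j : R := min_psi A B (minimizers A B j.-1).

End Angles.

Section Exponents.
Variable R : realType.

Definition irrational_space n (d e j : nat) : set {vspace 'cV[R]_n} :=
  [set A | \dim A = d /\
     forall B, rational_space e B -> (\dim (A :&: B)%VS < j)%N].

Definition mu n (A : {vspace 'cV[R]_n}) (e j : nat) : \bar R :=
  ereal_sup [set b%:E | b in [set b : R | 0 < b /\
    infinite_set [set B : {vspace 'cV[R]_n} |
      rational_space e B /\ psi_space A B j <= height B `^ (- b)]]].

Definition mu_inf n (d e j : nat) : \bar R :=
  ereal_inf [set mu A e j | A in @irrational_space n d e j].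

End Exponents.

(* Main.v *)
Require Import Defs.
From HB Require Import structures.
From mathcomp Require Import all_boot all_order all_algebra.
From mathcomp Require Import all_fingroup all_solvable all_field.
From mathcomp Require Import zify ring.
From mathcomp Require Import all_classical all_reals all_analysis.

Set Implicit Arguments.
Unset Strict Implicit.
Unset Printing Implicit Defensive.

Import Order.TTheory GRing.Theory Num.Theory.
Local Open Scope ring_scope.

(** The infimum is bounded by means of one explicit subspace. Write n = d + f
    with d <= f. Let theta be a real root of a monic integer polynomial F of
    degree n that is irreducible modulo 2, and let A be spanned by the d
    vectors (theta ^ (j * 2 ^ i))_(j < n), for i < d: these are points of the
    moment curve, at the parameters theta, theta ^ 2, theta ^ 4, and so on.
    With G the matrix of these d columns, over Z[X] or evaluated at theta, and
    N an integer matrix with f columns that has an integer left inverse (that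
    is, the columns of N generate all the integer points of the rational
    subspace that they span), everything rests on D_N = det (G | N).

    - D_N does not vanish. Reduce modulo 2, so that theta becomes a generator
      alpha of the field with 2 ^ n elements. A vector in the kernel of
      (G | N) yields a polynomial sum_(i < d) a_i X ^ (2 ^ i), which is
      additive, has degree at most 2 ^ (d - 1) and vanishes on a space of
      dimension d over F_2; so it is zero ([moment_det_mod2]). This is the
      argument that a Gabidulin code has the maximal rank distance.
    - D_N is not small (Liouville). Let H bound the maximal minors of N.
      Substituting the companion matrix of F for X turns D_N into an integer
      matrix of odd determinant, with entries at most a constant times H, and
      with D_N (theta) as an eigenvalue. Hence |D_N (theta)| is at least
      c / H ^ (n - 1) ([moment_det_lower_bound]).
    - D_N is small if A and N nearly meet: if X is in A and Y in the span of
      N, then |D_N (theta)| <= C psi (X, Y) H ([psi_det_bound]). So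
      psi (X, Y) >= c / H ^ n.
    - A rational subspace B of dimension d - 1 lies in a rational subspace of
      dimension f whose height H satisfies H ^ (f + 1) <= C H(B) ^ d. This is
      the going-up theorem of Schmidt, proved one dimension at a time by the
      pigeonhole principle ([going_up]).

    Consequently psi_1 (A, B) >= c H(B) ^ (- n d / (f + 1)). As there are only
    finitely many rational subspaces of bounded height, the exponent of A is
    at most n d / (f + 1). This is at most 2 d ^ 2 / (d + 1), with equality
    for f = d. *)

(** * Determinants and maximal minors *)

(** Expansion along the first d columns shows that a determinant is controlled
    by the size of these columns and by the maximal minors of the others. The
    gauge nu is left abstract because the bound serves for integers, for reals
    and for integer polynomials measured through a matrix. *)
Lemma det_block_bound (S : comNzRingType) (K : numDomainType) (nu : S -> K)
    (nu0 : nu 0 = 0) (nuD : forall a b, nu (a + b) <= nu a + nu b)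
    (nuM : forall a b, nu (a * b) <= nu a * nu b)
    (nuN : forall a, nu (- a) = nu a) (nu_ge0 : forall a, 0 <= nu a)
    (d f : nat) (M : 'M[S]_(d + f)) (p : 'I_d -> K) (h : K)
    (hp : forall i j, nu (M i (lshift f j)) <= p j)
    (hh : forall g : 'I_f -> 'I_(d + f), nu (\det (rowsub g (rsubmx M))) <= h) :
  nu (\det M) <= (d + f)`!%:R * (\prod_j p j) * h.
Proof.
have nu_sign k x : nu ((-1) ^+ k * x) = nu x.
  by rewrite -signr_odd mulr_sign; case: odd.
elim: d M p hp hh => [|d IH] M p hp hh.
  have h0 : 0 <= h by apply: le_trans (hh id); apply: nu_ge0.
  rewrite big_ord0 mulr1.
  have -> : \det M = \det (rowsub (id : 'I_f -> 'I_(0 + f)) (rsubmx M)).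
    congr (\det _); apply/matrixP=> i j; rewrite !mxE.
    by congr (M _ _); apply: val_inj.
  apply: le_trans (hh _) _.
  by rewrite ler_peMl // ler1n fact_gt0.
have h0 : 0 <= h.
  by apply: le_trans (hh (fun j => rshift _ j)); apply: nu_ge0.
have p0 j : 0 <= p j by apply: le_trans (hp (lshift _ j) j); apply: nu_ge0.
rewrite big_ord_recl.
have cofb i : nu (cofactor M i ord0) <=
    (d + f)`!%:R * (\prod_j p (lift ord0 j)) * h.
  rewrite /cofactor nu_sign.
  apply: (IH (row' i (col' ord0 M))) => [k j|g].
    rewrite !mxE.
    have -> : lift ord0 (lshift f j) = lshift f (lift ord0 j) :> 'I_(d.+1 + f).
      by apply: val_inj.
    exact: hp.
  have := hh (fun x => lift i (g x)).
  congr (nu (\det _) <= _); apply/matrixP=> a b; rewrite !mxE.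
  by congr (M _ _); apply: val_inj.
rewrite (expand_det_col M ord0).
have nu_sum (I : Type) (r : seq I) (F : I -> S) :
    nu (\sum_(i <- r) F i) <= \sum_(i <- r) nu (F i).
  elim/big_rec2: _ => [|i y1 y2 _ IHr]; first by rewrite nu0.
  by apply: le_trans (nuD _ _) _; rewrite lerD2l.
apply: le_trans (nu_sum _ _ _) _.
apply: (@le_trans _ _ (\sum_(i < d.+1 + f) p ord0 *
   ((d + f)`!%:R * (\prod_j p (lift ord0 j)) * h))).
  apply: ler_sum => i _; apply: le_trans (nuM _ _) _.
  apply: ler_pM => //.
  have := hp i ord0; congr (nu (M _ _) <= _); exact: val_inj.
rewrite sumr_const card_ord -[X in X <= _]mulr_natl addSn factS natrM !mulrA.
by rewrite [_ * p ord0 * _]mulrAC.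
Qed.

Lemma det_norm_bound (K : numDomainType) m (M : 'M[K]_m) (b : K) :
  (forall i j, `|M i j| <= b) -> `|\det M| <= m`!%:R * b ^+ m.
Proof.
move=> hb; apply: le_trans (ler_norm_sum _ _ _) _.
rewrite -{1}(card_Sn m) -[X in X%:R](sum1_card) natr_sum mulr_suml.
apply: ler_sum => s _; rewrite normrM normrX normrN1 expr1n !mul1r.
rewrite normr_prod -[X in _ <= _ ^+ X](card_ord m) -prodr_const.
by apply: ler_prod => i _; rewrite normr_ge0 hb.
Qed.

(** The Plücker coordinates are indexed by increasing row choices only, while
    arbitrary maps are what determinant expansions produce. *)
Lemma det_rowsub_sorted (S : comNzRingType) n e (g : 'I_e -> 'I_n) :
  (forall M : 'M[S]_(n, e), \det (rowsub g M) = 0) \/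
  exists (c : row_choice n e) (b : bool), forall M : 'M[S]_(n, e),
    \det (rowsub g M) = (-1) ^+ b * \det (rowsub (fun i => val c i) M).
Proof.
have [/injectiveP ginj|] := boolP (injectiveb g); last first.
  move=> /injectivePn [i [j ij gij]].
  left=> M; rewrite (determinant_alternate ij) // => k.
  by rewrite !mxE gij.
right.
pose t := [tuple g i | i < e].
pose s := sort (fun x y : 'I_n => (x <= y)%N) t.
have szs : size s == e by rewrite size_sort size_tuple.
have /tuple_permP [p sp] : perm_eq s t.
  by rewrite /s; apply/permPl; apply: perm_sort.
have gp i : nth (g i) s i = g (p i).
  have -> : s = [tuple tnth t (p i) | i < e] :> seq _ by [].
  by rewrite (nth_map i) ?size_enum_ord // nth_ord_enum tnth_mktuple.
have ssort : sorted (fun x y : 'I_n => (x < y)%N) s.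
  have : sorted (fun x y : 'I_n => (x <= y)%N) s.
    by apply: sort_sorted => x y; apply: leq_total.
  have us : uniq (map val s).
    rewrite (map_inj_uniq val_inj) sort_uniq.
    by rewrite map_inj_uniq ?enum_uniq //.
  by have := ltn_sorted_uniq_leq (map val s); rewrite us !sorted_map => ->.
pose h : {ffun 'I_e -> 'I_n} := [ffun i => g (p i)].
have inc : [forall i : 'I_e, forall j : 'I_e, (i < j)%N ==> (h i < h j)%N].
  apply/forallP=> i; apply/forallP=> j; apply/implyP=> ij; rewrite !ffunE.
  rewrite -!gp (set_nth_default (g i)) ?(eqP szs) ?ltn_ord //.
  apply: (sorted_ltn_nth _ _ ssort); rewrite ?inE ?(eqP szs) ?ltn_ord //.
  by move=> x y z; apply: ltn_trans.
pose c : row_choice n e := exist _ h inc.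
exists c, (odd_perm p) => M /=.
have -> : rowsub h M = row_perm p (rowsub g M).
  by apply/matrixP=> i j; rewrite !mxE ffunE.
by rewrite row_permE det_mulmx det_perm mulrA -signr_addb addbb mul1r.
Qed.

(** The Cauchy-Binet formula, before the terms are grouped by image. *)
Lemma det_mulmx_rowsub (S : comNzRingType) (n e : nat)
    (V : 'M[S]_(e, n)) (N : 'M[S]_(n, e)) :
  \det (V *m N) =
  \sum_(g : {ffun 'I_e -> 'I_n}) (\prod_i V i (g i)) * \det (rowsub g N).
Proof.
rewrite /determinant.
transitivity (\sum_(s : 'S_e) \sum_(g : {ffun 'I_e -> 'I_n})
    (-1) ^+ s * \prod_i (V i (g i) * N (g i) (s i))).
  apply: eq_bigr => s _; rewrite -mulr_sumr; congr (_ * _).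
  rewrite -(bigA_distr_bigA (fun i k => V i k * N k (s i))) /=.
  by apply: eq_bigr => i _; rewrite mxE.
rewrite exchange_big; apply: eq_bigr => g _ /=.
rewrite mulr_sumr; apply: eq_bigr => s _.
rewrite big_split /= mulrCA; congr (_ * (_ * _)).
by apply: eq_bigr => i _; rewrite !mxE.
Qed.

Lemma det_replace_column (S : comNzRingType) (n : nat) (M : 'M[S]_n)
    (Z : 'cV[S]_n) (k : 'I_n) :
  \det (\matrix_(i, j) if j == k then Z i 0 else M i j) =
  (\adj M *m Z) k 0.
Proof.
rewrite (expand_det_col _ k) mxE; apply: eq_bigr => i _.
rewrite !mxE eqxx mulrC; congr (_ * _); rewrite /cofactor; congr (_ * \det _).
by apply/matrixP=> a b; rewrite !mxE eq_sym (negbTE (neq_lift _ _)).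
Qed.

(** Cramer's rule: the matrix M normalised on the rows g has minors of M as
    its entries, so the minors of M determine its column space. *)
Lemma mulmx_adj_rowsub (S : comNzRingType) (n e : nat) (M : 'M[S]_(n, e))
    (g : 'I_e -> 'I_n) i j :
  (M *m \adj (rowsub g M)) i j =
  \det (rowsub (fun k => if k == j then i else g k) M).
Proof.
rewrite (expand_det_row _ j) mxE; apply: eq_bigr => k _.
rewrite !mxE eqxx; congr (_ * _); rewrite /cofactor; congr (_ * \det _).
by apply/matrixP=> a b; rewrite !mxE eq_sym (negbTE (neq_lift _ _)).
Qed.

(** * Nonvanishing modulo 2 *)

(** The witness is a generator of the multiplicative group of the field with
    2 ^ n elements: it generates the field over F_2, so its degree is n. *)
Lemma binary_field_generator n : (0 < n)%N ->
  exists (L : fieldType) (iota : {rmorphism 'F_2 -> L}) (alpha : L)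
    (h : {poly 'F_2}),
    [/\ 2%N \in [pchar L], h \is monic, size h = n.+1,
        root (map_poly iota h) alpha &
        forall p : {poly 'F_2}, (size p <= n)%N ->
          root (map_poly iota p) alpha -> p = 0].
Proof.
move=> n0; have [F charF cardF] := @pPrimePowerField 2 n isT n0.
pose L : fieldExtType 'F_2 := pPrimeCharType charF.
have /cyclicP [u gen_u] := field_unit_group_cyclic [set: {unit F}].
pose al : L := val u.
have gen_al (x : L) : x \in <<1; al>>%VS.
  have [->|x0] := eqVneq x 0; first exact: mem0v.
  have ux : (x : F) \is a GRing.unit by rewrite unitfE.
  have : FinRing.unit F ux \in <[u]>%g by rewrite -gen_u inE.
  move=> /cycleP [k Ek]; have -> : x = al ^+ k.
    by have := congr1 val Ek; rewrite /= FinRing.val_unitX.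
  by rewrite rpredX // memv_adjoin.
have dimL : \dim {: L} = n.
  have := pprimeChar_dimf charF; rewrite cardF pfactorK // => <-.
have deg : adjoin_degree 1 al = n.
  have := dim_Fadjoin 1 al; rewrite dimv1 muln1 => <-.
  suff -> : <<1; al>>%VS = fullv by [].
  by apply/vspaceP=> x; rewrite gen_al memvf.
have /polyOver1P [h Eh] := minPolyOver 1 al.
exists L, (in_alg L), al, h; split.
- exact: charF.
- by rewrite -(map_monic (in_alg L)) -Eh monic_minPoly.
- by rewrite -(size_map_poly (in_alg L)) -Eh size_minPoly deg.
- by rewrite -Eh root_minPoly.
- move=> p sp rp.
  have /dvdp_leq : minPoly 1 al %| map_poly (in_alg L) p.
    apply: minPoly_dvdp => //; apply/polyOver1P; by exists p.
  rewrite size_minPoly deg map_poly_eq0 size_map_poly => H.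
  apply/eqP; apply: contraTT sp => p0; rewrite -ltnNge.
  exact: H.
Qed.

Lemma linear_frobenius (L : fieldType) (iota : {rmorphism 'F_2 -> L})
    (char2 : 2%N \in [pchar L]) (I : Type) (r : seq I) (c : I -> 'F_2)
    (x : I -> L) (i : nat) :
  (\sum_(k <- r) iota (c k) * x k) ^+ (2 ^ i) =
  \sum_(k <- r) iota (c k) * x k ^+ (2 ^ i).
Proof.
elim: i => [|i IH].
  by rewrite expn0 expr1; apply: eq_bigr => k _; rewrite expr1.
rewrite expnSr exprM IH -(pFrobenius_autE char2) rmorph_sum /=.
apply: eq_bigr => k _; rewrite pFrobenius_autE exprMn -exprM -rmorphXn /=.
by congr (iota _ * _); case: (c k) => [[|[|//]] lt]; apply: val_inj.
Qed.

(** The Moore matrix of elements independent over F_2 is nonsingular: a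
    relation a between its columns would be an additive polynomial of degree
    at most 2 ^ (d - 1) with the 2 ^ d combinations of the be k as roots. *)
Lemma moore_nonsingular (L : fieldType) (iota : {rmorphism 'F_2 -> L})
    (char2 : 2%N \in [pchar L]) (d : nat) (be : 'I_d -> L)
    (free_be : forall c : 'rV['F_2]_d, \sum_k iota (c 0 k) * be k = 0 -> c = 0)
    (a : 'I_d -> L) :
  (forall k, \sum_(i < d) a i * be k ^+ (2 ^ i) = 0) -> forall i, a i = 0.
Proof.
move=> Ha.
pose P : {poly L} := \sum_(i < d) a i *: 'X^(2 ^ i).
pose s (c : 'rV['F_2]_d) := \sum_k iota (c 0 k) * be k.
have sD c c' : s (c - c') = s c - s c'.
  rewrite /s -sumrB; apply: eq_bigr => k _.
  by rewrite !mxE rmorphB mulrBl.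
have s_inj : injective s.
  move=> c c' E; apply/eqP; rewrite -subr_eq0; apply/eqP/free_be.
  by have := sD c c'; rewrite E subrr.
have rootP c : root P (s c).
  rewrite /root /P horner_sum.
  have -> : \sum_(i < d) (a i *: 'X^(2 ^ i)).[s c] =
     \sum_(i < d) \sum_k iota (c 0 k) * (a i * be k ^+ (2 ^ i)).
    apply: eq_bigr => i _; rewrite hornerZ hornerXn.
    rewrite linear_frobenius // mulr_sumr.
    by apply: eq_bigr => k _; rewrite mulrCA.
  rewrite exchange_big big1 // => k _ /=.
  by rewrite -mulr_sumr Ha mulr0.
have P0 : P = 0.
  apply/eqP; apply: contraT => nzP.
  have := max_poly_roots nzP (rs := [seq s c | c : 'rV['F_2]_d]).
  have -> : all (root P) [seq s c | c : 'rV['F_2]_d].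
    by apply/allP=> x /mapP [c _ ->].
  have -> : uniq [seq s c | c : 'rV['F_2]_d] by rewrite map_inj_uniq ?enum_uniq.
  rewrite size_map -cardE card_mx card_Fp // mul1n => /(_ isT isT).
  rewrite ltnNge => /negP; case.
  apply: (leq_trans (size_sum _ _ _)); apply/bigmax_leqP => i _.
  apply: (leq_trans (size_scale_leq _ _)); rewrite size_polyXn.
  by rewrite ltn_exp2l.
move=> i; have := congr1 (fun p : {poly L} => p`_(2 ^ i)) P0.
rewrite coef0 coef_sum (bigD1 i) //= coefZ coefXn eqxx mulr1 big1 ?addr0 //.
move=> j ij; rewrite coefZ coefXn eqn_exp2l // [_ == _](negbTE _) ?mulr0 //.
by rewrite eq_sym.
Qed.

Definition moment_mx (n d : nat) : 'M[{poly int}]_(n, d) :=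
  \matrix_(j, i) 'X^(j * 2 ^ i).

(** The polynomial D_N of the introduction. *)
Definition moment_det (d f : nat) (N : 'M[int]_(d + f, f)) : {poly int} :=
  \det (row_mx (moment_mx (d + f) d) (map_mx polyC N)).

(** Choose W over F_2, of rank d, with W N = 0. A kernel vector (a, b) of
    (G | N) gives W G a = 0; and W G is the Moore matrix of the elements
    sum_j W_kj alpha ^ j, which are independent over F_2. *)
Lemma moment_det_mod2 (L : fieldType) (iota : {rmorphism 'F_2 -> L})
    (char2 : 2%N \in [pchar L]) (d f : nat) (alpha : L)
    (free_alpha : forall p : {poly 'F_2}, (size p <= d + f)%N ->
       root (map_poly iota p) alpha -> p = 0)
    (N : 'M[int]_(d + f, f)) (V : 'M[int]_(f, d + f)) (VN : V *m N = 1%:M) :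
  ~~ root (map_poly iota (map_poly intr (moment_det N))) alpha.
Proof.
pose phi : {rmorphism {poly int} -> L} :=
  horner_eval alpha \o map_poly iota \o map_poly (intr : int -> 'F_2).
pose NF : 'M['F_2]_(d + f, f) := map_mx intr N.
pose VF : 'M['F_2]_(f, d + f) := map_mx intr V.
have VNF : VF *m NF = 1%:M by rewrite -map_mxM VN map_mx1.
pose G : 'M[L]_(d + f, d) := \matrix_(j, i) alpha ^+ (j * 2 ^ i).
have phi_det : phi (moment_det N) = \det (row_mx G (map_mx iota NF)).
  rewrite -det_map_mx map_row_mx; congr (\det (row_mx _ _)).
    apply/matrixP=> j i; rewrite !mxE /phi /= !map_polyXn.
    by rewrite /horner_eval hornerXn.
  by apply/matrixP=> j i; rewrite !mxE /phi /= !map_polyC /horner_eval hornerC.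
change (phi (moment_det N) != 0); rewrite phi_det -det_tr.
apply/negP => /det0P [v v0 Av].
have := congr1 trmx Av; rewrite trmx_mul trmxK trmx0.
rewrite -[v^T]vsubmxK mul_row_col.
set a := usubmx _; set b := dsubmx _ => E.
have [W frW WN] : exists2 W : 'M['F_2]_(d, d + f), row_free W & W *m NF = 0.
  have rk : \rank (kermx NF) = d.
    rewrite mxrank_ker; have -> : \rank NF = f; last by rewrite addnK.
    apply/eqP; rewrite eqn_leq rank_leq_col /=.
    by have := mxrankM_maxr VF NF; rewrite VNF mxrank1.
  have : exists2 W : 'M['F_2]_(\rank (kermx NF), d + f),
      row_free W & W *m NF = 0.
    exists (row_base (kermx NF)); first exact: row_base_free.
    by apply/sub_kermxP; rewrite eq_row_base.
  by rewrite rk.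
pose be k := \sum_j iota (W k j) * alpha ^+ (nat_of_ord j).
have free_be (c : 'rV['F_2]_d) : \sum_k iota (c 0 k) * be k = 0 -> c = 0.
  move=> sc0.
  have cW0 : rVpoly (c *m W) = 0.
    apply: free_alpha; first exact: size_poly.
    apply/eqP; rewrite -[RHS]sc0.
    have -> : map_poly iota (rVpoly (c *m W)) =
              \sum_(j < d + f) iota ((c *m W) 0 j) *: 'X^j.
      rewrite /rVpoly poly_def rmorph_sum; apply: eq_bigr => j _ /=.
      rewrite insubT // => lt_j; rewrite map_polyZ map_polyXn /=.
      by congr (iota (_ _ _) *: _); apply: val_inj.
    rewrite horner_sum /be.
    under [RHS]eq_bigr do rewrite mulr_sumr.
    rewrite exchange_big; apply: eq_bigr => j _ /=.
    rewrite hornerZ hornerXn mxE rmorph_sum mulr_suml.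
    by apply: eq_bigr => k _; rewrite rmorphM mulrA.
  have /eqP := congr1 (poly_rV (d := d + f)) cW0.
  rewrite rVpolyK raddf0 => /eqP cW.
  by apply: (row_free_inj frW); rewrite cW mul0mx.
have a0 : a = 0.
  apply/matrixP=> i j; rewrite ord1 [RHS]mxE.
  move: i; apply: (moore_nonsingular char2 free_be) => k.
  transitivity ((map_mx iota W *m (G *m a)) k 0).
    rewrite mulmxA mxE; apply: eq_bigr => i _.
    rewrite mulrC /be linear_frobenius //; congr (_ * _).
    by rewrite mxE; apply: eq_bigr => l _; rewrite !mxE exprM.
  have -> : G *m a = - (map_mx iota NF *m b).
    by apply/eqP; rewrite -addr_eq0 E.
  by rewrite mulmxN mulmxA -map_mxM WN map_mx0 mul0mx oppr0 mxE.
have b0 : b = 0.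
  move: E; rewrite a0 mulmx0 add0r => /(congr1 (mulmx (map_mx iota VF))).
  by rewrite mulmxA -map_mxM VNF map_mx1 mul1mx mulmx0.
move/eqP: v0; apply; apply: trmx_inj.
by rewrite -[v^T]vsubmxK -/a -/b a0 b0 col_mx0 trmx0.
Qed.

(** * A Liouville inequality *)

(** Lift the coefficients of h to 0 and 1, and subtract 2 from the constant
    term: the value at 0 becomes negative, while the value at 2 is at least
    2 ^ (n + 1) - 2, so there is a root in between. *)
Lemma monic_lift_with_root (R : rcfType) (n : nat) (h : {poly 'F_2}) :
  h \is monic -> size h = n.+2 ->
  exists (F : {poly int}) (theta : R),
    [/\ F \is monic, size F = n.+2, map_poly intr F = h &
        root (map_poly intr F) theta].
Proof.
move=> monh szh.
pose lft (x : 'F_2) : int := (x : nat)%:Z.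
have lft0 : lft 0 = 0 by [].
have lft1 : lft 1 = 1 by [].
have lftK (x : 'F_2) : (lft x)%:~R = x.
  by rewrite /lft -pmulrn natr_Zp.
pose F0 := \poly_(i < n.+2) lft h`_i.
pose F := F0 - 2%:P.
have lead1 : h`_n.+1 = 1 by move: monh; rewrite monicE /lead_coef szh => /eqP.
have szF0 : size F0 = n.+2.
  by rewrite size_poly_eq // lead1 lft1.
have szc : (size (- (2%:P) : {poly int}) < size F0)%N.
  rewrite size_polyN szF0; apply: leq_ltn_trans (size_polyC_leq1 _) _.
  by [].
have szF : size F = n.+2 by rewrite /F size_polyDl.
have monF : F \is monic.
  rewrite monicE /F lead_coefDl // /lead_coef szF0 coef_poly ltnSn lead1.
  by rewrite lft1.
have redF : map_poly intr F = h.
  apply/polyP=> i; rewrite coef_map /= coefB coefC coef_poly rmorphB /=.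
  have -> : ((if i == 0%N then (2 : int) else 0)%:~R : 'F_2) = 0.
    by case: (i == 0%N) => //; apply: val_inj.
  rewrite subr0; case: ltnP => [_|lei]; first exact: lftK.
  by rewrite nth_default // szh.
have lft_ge0 x : 0 <= ((lft x)%:~R : R) by rewrite ler0z.
have lft_le1 x : ((lft x)%:~R : R) <= 1.
  rewrite -[1]/(1%:~R) ler_int /lft lez_nat.
  by case: x => [[|[|//]]].
have FR : map_poly intr F =
    \sum_(i < n.+2) (lft h`_i)%:~R *: 'X^i - 2%:P :> {poly R}.
  rewrite rmorphB /= /F0 poly_def rmorph_sum /= map_polyC /=; congr (_ - _).
  by apply: eq_bigr => i _; rewrite map_polyZ map_polyXn.
have evF x : (map_poly intr F).[x] =
    \sum_(i < n.+2) (lft h`_i)%:~R * x ^+ i - 2 :> R.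
  rewrite FR hornerD hornerN hornerC horner_sum; congr (_ - _).
  by apply: eq_bigr => i _; rewrite hornerZ hornerXn.
have F0neg : (map_poly intr F).[0] <= 0 :> R.
  rewrite evF big_ord_recl /= expr0 mulr1 big1 ?addr0; last first.
    by move=> i _; rewrite expr0n /= mulr0.
  rewrite subr_le0; apply: le_trans (lft_le1 _) _.
  by rewrite ler1n.
have F2pos : 0 <= (map_poly intr F).[2] :> R.
  rewrite evF big_ord_recr /= lead1 lft1 mul1r subr_ge0.
  have h2 : (2 : R) <= 2 ^+ n.+1.
    by rewrite exprS ler_peMr // exprn_ege1 // ler1n.
  apply: le_trans h2 _; rewrite lerDr; apply: sumr_ge0 => i _.
  by rewrite mulr_ge0 // exprn_ge0.
have [theta _ rt] := @poly_ivt R (map_poly intr F) 0 2 (ler0n _ _)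
   (introT andP (conj F0neg F2pos)).
by exists F, theta.
Qed.

Lemma companion_exists (F : {poly int}) (n : nat) :
  F \is monic -> size F = n.+2 -> exists C : 'M[int]_n.+1, char_poly C = F.
Proof.
move=> monF szF; have := companionmxK monF.
move: (companionmx F); have -> : (size F).-1 = n.+1 by rewrite szF.
by move=> C <-; exists C.
Qed.

(** The determinant is the resultant of p and the characteristic polynomial of
    C. Modulo 2 these are coprime, so a Bezout relation evaluated at C inverts
    the reduction of p (C), by the Cayley-Hamilton theorem. *)
Lemma det_horner_mx_neq0 (L : fieldType) (iota : {rmorphism 'F_2 -> L})
    (n : nat) (alpha : L) (h : {poly 'F_2}) (monh : h \is monic)
    (szh : size h = n.+2) (rh : root (map_poly iota h) alpha)
    (free_alpha : forall p : {poly 'F_2}, (size p <= n.+1)%N ->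
       root (map_poly iota p) alpha -> p = 0)
    (C : 'M[int]_n.+1) (Ch : map_poly intr (char_poly C) = h)
    (p : {poly int}) (rp : ~~ root (map_poly iota (map_poly intr p)) alpha) :
  \det (horner_mx C p) != 0.
Proof.
set q : {poly 'F_2} := map_poly intr p in rp.
have h0 : h != 0 by apply: monic_neq0.
have cop : coprimep q h.
  rewrite /coprimep; set g := gcdp q h.
  have gh : g %| h by apply: dvdp_gcdr.
  have gq : g %| q by apply: dvdp_gcdl.
  have g0 : g != 0 by rewrite gcdp_eq0 negb_and h0 orbT.
  have Eh : h = (h %/ g) * g by rewrite divpK.
  have ng : ~~ root (map_poly iota g) alpha.
    apply: contra rp => rg.
    by rewrite -(divpK gq) rmorphM rootM rg orbT.
  have rk : root (map_poly iota (h %/ g)) alpha.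
    by move: rh; rewrite {1}Eh rmorphM rootM (negbTE ng) orbF.
  have g1 : (0 < size g)%N by rewrite size_poly_gt0.
  rewrite eqn_leq g1 andbT leqNgt; apply/negP => g2.
  have k0 : h %/ g = 0.
    apply: free_alpha rk; rewrite size_divp // szh.
    by case: (size g) g2 => [|[|s]] //= _; rewrite subSS leq_subr.
  by move: h0; rewrite {1}Eh k0 mul0r eqxx.
pose C2 : 'M['F_2]_n.+1 := map_mx intr C.
have CH : horner_mx C2 h = 0.
  have := Cayley_Hamilton C2.
  by rewrite -(map_char_poly (intr : int -> 'F_2)) Ch.
have /Bezout_eq1_coprimepP [[u v] /= Euv] := cop.
have H1 : horner_mx C2 u *m horner_mx C2 q = 1%:M.
  have := congr1 (horner_mx C2) Euv.
  by rewrite rmorphD !rmorphM /= CH mulr0 addr0 rmorph1.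
have unit_q : \det (horner_mx C2 q) != 0.
  rewrite -unitfE -[_ \is a _]/(horner_mx C2 q \in unitmx).
  by case: (mulmx1_unit H1).
apply: contraNneq unit_q => d0.
have <- : map_mx (intr : int -> 'F_2) (horner_mx C p) = horner_mx C2 q.
  exact: map_horner_mx.
by rewrite det_map_mx d0 rmorph0.
Qed.

(** The sum of absolute values is a submultiplicative gauge on matrices; this
    allows the size of p (C) to be bounded without looking at the coefficients
    or the degree of p. *)
Definition mx_abs_sum (m : nat) (A : 'M[int]_m) : int :=
  \sum_i \sum_j `|A i j|.

Lemma mx_abs_sum_ge0 (m : nat) (A : 'M[int]_m) : 0 <= mx_abs_sum A.
Proof. by apply: sumr_ge0 => i _; apply: sumr_ge0. Qed.

Lemma mx_abs_sum0 (m : nat) : mx_abs_sum (0 : 'M[int]_m) = 0.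
Proof.
by rewrite /mx_abs_sum !big1 // => i _; rewrite big1 // => j _; rewrite mxE.
Qed.

Lemma mx_abs_sumN (m : nat) (A : 'M[int]_m) : mx_abs_sum (- A) = mx_abs_sum A.
Proof.
by apply: eq_bigr => i _; apply: eq_bigr => j _; rewrite mxE normrN.
Qed.

Lemma mx_abs_sumD (m : nat) (A B : 'M[int]_m) :
  mx_abs_sum (A + B) <= mx_abs_sum A + mx_abs_sum B.
Proof.
rewrite /mx_abs_sum -big_split; apply: ler_sum => i _.
rewrite -big_split; apply: ler_sum => j _ /=.
by rewrite mxE ler_normD.
Qed.

Lemma ler_mx_abs_sum (m : nat) (A : 'M[int]_m) i j : `|A i j| <= mx_abs_sum A.
Proof.
rewrite /mx_abs_sum (bigD1 i) //= (bigD1 j) //= -addrA.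
apply: ler_wpDr => //; apply: addr_ge0; apply: sumr_ge0 => // k _.
exact: sumr_ge0.
Qed.

Lemma mx_abs_sumM (m : nat) (A B : 'M[int]_m) :
  mx_abs_sum (A *m B) <= mx_abs_sum A * mx_abs_sum B.
Proof.
rewrite /mx_abs_sum mulr_suml; apply: ler_sum => i _.
apply: (@le_trans _ _ (\sum_j \sum_k `|A i k| * `|B k j|)).
  apply: ler_sum => j _; rewrite mxE.
  apply: le_trans (ler_norm_sum _ _ _) _; apply: ler_sum => k _.
  by rewrite normrM.
rewrite exchange_big mulr_suml; apply: ler_sum => k _ /=.
rewrite -mulr_sumr ler_wpM2l // [leRHS](bigD1 k) //=.
by apply: ler_wpDr => //; apply: sumr_ge0 => l _; apply: sumr_ge0.
Qed.

(** An eigenvector v of the companion matrix C satisfies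
    det (D_N (C)) v = D_N (theta) v adj (D_N (C)). On the left the determinant
    is a nonzero integer; on the right the adjugate consists of minors of
    order n - 1, of size at most a constant times H ^ (n - 1). *)
Lemma moment_det_lower_bound (R : rcfType) (d f : nat) : (0 < d + f)%N ->
  exists (theta c : R), 0 < c /\
    forall (N : 'M[int]_(d + f, f)) (V : 'M[int]_(f, d + f)) (H : R),
      V *m N = 1%:M ->
      (forall g : 'I_f -> 'I_(d + f), `|\det (rowsub g N)|%:~R <= H) ->
      c <= `|(map_poly intr (moment_det N)).[theta]| * H ^+ (d + f).-1.
Proof.
move=> df0; set m := (d + f).-1.
have Em : (d + f)%N = m.+1 by rewrite prednK.
have [L [iota [alpha [h [char2 monh szh rh free_alpha]]]]] :=
  @binary_field_generator (d + f) df0.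
have szh' : size h = m.+2 by rewrite szh Em.
have free_alpha' (p : {poly 'F_2}) : (size p <= m.+1)%N ->
    root (map_poly iota p) alpha -> p = 0 by rewrite -Em; apply: free_alpha.
have [F [theta [monF szF redF rootF]]] := monic_lift_with_root R monh szh'.
have [C CF] := companion_exists monF szF.
pose ev : {rmorphism {poly int} -> R} :=
  horner_eval theta \o map_poly (intr : int -> R).
have /eigenvalueP [v Cv v0] : eigenvalue (map_mx intr C : 'M[R]_m.+1) theta.
  by rewrite eigenvalue_root_char -map_char_poly CF.
have Dv p : v *m map_mx intr (horner_mx C p) = ev p *: v.
  elim/poly_ind: p => [|p c IH].
    by rewrite !rmorph0 ?map_mx0 mulmx0 scale0r.
  rewrite !rmorphD !rmorphM /= horner_mx_X horner_mx_C.
  rewrite mulmxDr mulmxA IH -scalemxAl Cv scalerA.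
  rewrite map_scalar_mx mul_mx_scalar -scalerDl /horner_eval.
  by rewrite map_polyX map_polyC hornerX hornerC.
have [i vi0] : exists i, v 0 i != 0.
  apply/existsP; apply: contraR v0; rewrite negb_exists => /forallP v0.
  by apply/eqP/rowP => j; rewrite mxE; apply/eqP; move: (v0 j); rewrite negbK.
pose nu (p : {poly int}) : R := (mx_abs_sum (horner_mx C p))%:~R.
have nu_ge0 p : 0 <= nu p by rewrite ler0z mx_abs_sum_ge0.
pose K0 : R :=
  (d + f)`!%:R * \prod_j (\sum_k nu (moment_mx (d + f) d k j)) * nu 1.
have K0_ge0 : 0 <= K0.
  rewrite mulr_ge0 ?nu_ge0 // mulr_ge0 //; apply: prodr_ge0 => j _.
  by apply: sumr_ge0 => k _; apply: nu_ge0.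
(* K0 + 1 instead of K0 keeps the constant positive *)
pose K1 := (\sum_j `|v 0 j|) * (m`!%:R * (K0 + 1) ^+ m).
have K1_gt0 : 0 < K1.
  rewrite mulr_gt0 //; last first.
    by rewrite mulr_gt0 ?ltr0n ?fact_gt0 ?exprn_gt0 ?ltr_wpDl.
  rewrite (bigD1 i) //=; apply: ltr_pwDl; first by rewrite normr_gt0.
  exact: sumr_ge0.
exists theta, (`|v 0 i| / K1); split; first by rewrite divr_gt0 ?normr_gt0.
move=> N V H VN HN; set del := moment_det N.
have detD : \det (horner_mx C del) != 0.
  apply: (det_horner_mx_neq0 monh szh' rh free_alpha'); first by rewrite CF.
  exact: (moment_det_mod2 char2 free_alpha VN).
have H0 : 0 <= H by apply: le_trans (HN (@rshift d f)); rewrite ler0z.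
have nu_del : nu del <= K0 * H.
  rewrite /K0 -mulrA [nu 1 * H]mulrC; apply: det_block_bound => //.
  - by rewrite /nu rmorph0 mx_abs_sum0.
  - by move=> p q; rewrite /nu -intrD ler_int rmorphD mx_abs_sumD.
  - by move=> p q; rewrite /nu -intrM ler_int rmorphM mx_abs_sumM.
  - by move=> p; rewrite /nu rmorphN mx_abs_sumN.
  - move=> k l; rewrite row_mxEl.
    by rewrite [leRHS](bigD1 k) //= ler_wpDr // sumr_ge0.
  - move=> g; rewrite row_mxKr -map_mxsub det_map_mx.
    have -> : nu (\det (mxsub g id N))%:P = `|\det (rowsub g N)|%:~R * nu 1.
      rewrite /nu -intrM; congr (_%:~R).
      rewrite horner_mx_C rmorph1 /mx_abs_sum mulr_sumr; apply: eq_bigr => k _.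
      rewrite mulr_sumr; apply: eq_bigr => l _; rewrite !mxE.
      by case: (k == l); rewrite ?mulr1n ?mulr0n ?normr1 ?mulr1 ?normr0 ?mulr0.
    by rewrite ler_wpM2r.
have D_le k l : `|horner_mx C del k l|%:~R <= (K0 + 1) * H.
  apply: (@le_trans _ _ (nu del)).
    by rewrite ler_int ler_mx_abs_sum.
  by apply: le_trans nu_del _; rewrite ler_wpM2r // ler_wpDr.
have adj_le k l : `|\adj (horner_mx C del) k l|%:~R <=
     m`!%:R * ((K0 + 1) * H) ^+ m.
  rewrite mxE /cofactor normrM normrX normrN1 expr1n mul1r intr_norm.
  rewrite -det_map_mx; apply: det_norm_bound => x y.
  by rewrite !mxE -intr_norm; apply: D_le.
have E : (\det (horner_mx C del))%:~R *: v =
    ev del *: (v *m map_mx intr (\adj (horner_mx C del))).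
  rewrite scalemxAl -Dv -mulmxA -map_mxM mul_mx_adj map_scalar_mx.
  by rewrite mul_mx_scalar.
have Ei := congr1 (fun w : 'rV_m.+1 => `|w 0 i|) E.
rewrite /= !mxE !normrM in Ei.
rewrite ler_pdivrMr //.
apply: (@le_trans _ _ (`|\det (horner_mx C del)|%:~R * `|v 0 i|)).
  rewrite ler_peMl // -[1]/(1%:~R) ler_int.
  by rewrite -gtz0_ge1 normr_gt0.
rewrite intr_norm Ei -mulrA ler_wpM2l // -[leRHS]/(H ^+ m * K1).
have -> : H ^+ m * K1 = \sum_j `|v 0 j| * (m`!%:R * ((K0 + 1) * H) ^+ m).
  by rewrite -mulr_suml /K1 exprMn; ring.
apply: le_trans (ler_norm_sum _ _ _) _; apply: ler_sum => j _.
by rewrite normrM ler_wpM2l // mxE -intr_norm; apply: adj_le.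
Qed.

(** * Going up: rational subspaces containing a given one *)

(** Integer matrices whose columns generate all the integer points of their
    span: if X = N y is an integer vector, then so is y = V X. *)
Definition left_invertible (n e : nat) (N : 'M[int]_(n, e)) :=
  exists V : 'M[int]_(e, n), V *m N = 1%:M.

Definition minors_le (n e : nat) (N : 'M[int]_(n, e)) (h : int) :=
  forall g : 'I_e -> 'I_n, `|\det (rowsub g N)| <= h.

(** The largest maximal minor of N is nonzero, because the expansion of
    det (V N) = 1 would vanish otherwise. Its rows are the coordinates on which
    the arguments below project. *)
Lemma left_invertible_max_minor (n e : nat) (N : 'M[int]_(n, e)) :
  left_invertible N ->
  exists g : 'I_e -> 'I_n, \det (rowsub g N) != 0 /\
    minors_le N `|\det (rowsub g N)|.
Proof.
move=> [V VN].
have [g0 hg0] : exists g : {ffun 'I_e -> 'I_n}, \det (rowsub g N) != 0.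
  apply/existsP; apply: contraT; rewrite negb_exists => /forallP all0.
  have := det_mulmx_rowsub V N; rewrite VN det1 big1 => [/eqP|g _].
    by rewrite oner_eq0.
  by move: (all0 g); rewrite negbK => /eqP ->; rewrite mulr0.
pose m (g : {ffun 'I_e -> 'I_n}) := `|\det (rowsub g N)|%N.
case: (@arg_maxnP _ g0 xpredT m isT) => g _ gmax.
exists g; split.
  by rewrite -absz_gt0; apply: leq_trans (gmax g0 isT); rewrite absz_gt0.
move=> g'; have := gmax [ffun i => g' i] isT.
rewrite /m /= -lez_nat !abszE; congr (`|\det _| <= _).
by apply/matrixP=> i j; rewrite !mxE ffunE.
Qed.

(** In the Smith form M = L D R, the first e columns of L generate the integer
    points of the span of M, and M is obtained from them by a matrix of nonzero
    integer determinant, which can only increase the minors. *)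
Lemma saturation (n e : nat) (M : 'M[int]_(n, e)) (g0 : 'I_e -> 'I_n) :
  \det (rowsub g0 M) != 0 ->
  exists (N : 'M[int]_(n, e)) (T : 'M[int]_e),
    [/\ left_invertible N, M = N *m T &
      forall g, `|\det (rowsub g N)| <= `|\det (rowsub g M)|].
Proof.
move=> detM.
have le_en : (e <= n)%N.
  rewrite -[e]card_ord -[n]card_ord; apply: (@leq_card _ _ g0) => i j gij.
  apply/eqP; apply: contraNT detM => ij; apply/eqP.
  by apply: (determinant_alternate ij) => k; rewrite !mxE gij.
have [L uL [R uR [d _ EM]]] := int_Smith_normal_form M.
pose N := L *m (pid_mx e : 'M[int]_(n, e)).
pose T := (\matrix_(i < e, j < e) (d`_i *+ (i == j))) *m R.
have EMN : M = N *m T.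
  rewrite EM /N /T !mulmxA; congr (_ *m _); rewrite -mulmxA; congr (_ *m _).
  apply/matrixP=> i j; rewrite !mxE (bigD1 j) //= !mxE eqxx mulr1n big1 ?addr0.
    by case: eqP => [->|_]; rewrite ?ltn_ord ?mul1r ?mul0r.
  by move=> k kj; rewrite !mxE (negbTE kj) mulr0.
exists N, T; split=> //.
  exists (pid_mx e *m invmx L).
  by rewrite /N mulmxA mulmxKV // mul_pid_mx !minnn (minn_idPr le_en) pid_mx_1.
have dT : \det T != 0.
  apply: contraNneq detM => dT0.
  by rewrite EMN -(mul_rowsub_mx _ N T) det_mulmx dT0 mulr0.
move=> g; rewrite EMN -(mul_rowsub_mx _ N T) det_mulmx normrM.
by rewrite ler_peMr // -gtz0_ge1 normr_gt0.
Qed.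

(** The index of the lattice A Z^e in Z^e is |det A|; the representatives are
    read off the Smith form. *)
Lemma index_representatives (e : nat) (A : 'M[int]_e) : \det A != 0 ->
  exists (T : finType) (y : T -> 'cV[int]_e), #|T| = `|\det A|%N /\
    forall a b z, y a - y b = A *m z -> a = b.
Proof.
move=> dA; have [L uL [R uR [d _ EA]]] := int_Smith_normal_form A.
have absdet (B : 'M[int]_e) : B \in unitmx -> `|\det B|%N = 1%N.
  by rewrite unitmxE => /orP [] /eqP ->.
have Dd : `|\det A|%N = (\prod_(i < e) absz (d`_i)%R)%N.
  rewrite EA !det_mulmx !abszM (absdet L) // (absdet R) // muln1 mul1n.
  have -> : \matrix_(i < e, j < e) (d`_i *+ (i == j :> nat)) =
      diag_mx (\row_i d`_i).
    by apply/matrixP=> i j; rewrite !mxE.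
  rewrite det_diag (big_morph absz abszM absz1).
  by apply: eq_bigr => i _; rewrite mxE.
pose T := {dffun forall i : 'I_e, 'I_(absz (d`_i)%R)}.
pose v (a : T) : 'cV[int]_e := \col_i (nat_of_ord (a i))%:Z.
exists T, (fun a => L *m v a); split.
  rewrite Dd card_dep_ffun foldrE big_map big_enum /=.
  by apply: eq_bigr => i _; rewrite card_ord.
move=> a b z; rewrite -mulmxBr EA -!mulmxA => /(can_inj (mulKmx uL)).
move: (R *m z) => w E.
apply/ffunP => i; apply: val_inj => /=.
have := congr1 (fun u : 'cV_e => u i 0) E.
rewrite !mxE (bigD1 i) //= !mxE eqxx mulr1n big1 ?addr0; last first.
  move=> k ki; rewrite !mxE [_ == _]eq_sym.
  by rewrite (negbTE ki : (k == i :> nat) = false) mulr0n mul0r.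
move=> Ei; have := ltn_ord (a i); have := ltn_ord (b i).
move: (nat_of_ord (a i)) (nat_of_ord (b i)) Ei => x y Ei hx hy.
have : (x%:Z == y%:Z %[mod d`_i])%Z by rewrite eqz_mod_dvd Ei dvdz_mulr.
rewrite -(modz_abs x%:Z) -(modz_abs y%:Z) !modz_nat !modn_small //.
by move=> /eqP [].
Qed.

(** Write A for the rows g of N and q = det A. An integer vector y is the
    A-part of a point N A^-1 y of the span of N, whose other coordinates are
    fractions of denominator q. According to the fractional parts of these,
    the |q| classes of y modulo A Z^e fall into M ^ (n - e) boxes, so two
    classes share a box. Then x is the difference of the two points, each
    rounded to an integer vector, and rho / q is what the rounding adds to a
    vector of the span. If rho were zero, x would be an integer point of the
    span, hence N times an integer vector because N is left invertible, and
    the two classes would coincide. *)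
Lemma pigeonhole_remainder (n e : nat) (N : 'M[int]_(n, e))
    (g : 'I_e -> 'I_n) (M : nat) :
  left_invertible N -> \det (rowsub g N) != 0 -> (0 < M)%N ->
  (M ^ (n - e) < `|\det (rowsub g N)|)%N ->
  exists (x rho : 'cV[int]_n) (c : 'cV[int]_e),
    [/\ \det (rowsub g N) *: x = N *m c + rho,
        forall i, rho (g i) 0 = 0, rho != 0 &
        forall j, `|rho j 0| * M%:Z <= `|\det (rowsub g N)|].
Proof.
move=> [V VN]; set A := rowsub g N; set q := \det A => q0 M0 hM.
have ginj : injective g.
  move=> i j gij; apply/eqP; apply: contraNT q0 => ij; apply/eqP.
  by apply: (determinant_alternate ij) => k; rewrite !mxE gij.
have [T [y [cardT yinj]]] := index_representatives q0.
pose K := N *m \adj A.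
have KA i (w : 'cV[int]_e) : (K *m w) (g i) 0 = q * w i 0.
  transitivity ((A *m \adj A *m w) i 0).
    by rewrite /K -!mulmxA [in RHS]/A mul_rowsub_mx [in RHS]mxE.
  by rewrite mul_mx_adj mul_scalar_mx mxE.
pose r a j := modz ((K *m y a) j 0) q.
have r_ge0 a j : 0 <= r a j by apply: modz_ge0.
have r_lt a j : (absz (r a j) < absz q)%N.
  by rewrite -ltz_nat abszE ger0_norm //; apply: ltz_mod.
have rg a i : r a (g i) = 0 by rewrite /r KA modzMr.
pose J : finType := {j : 'I_n | j \notin codom g}.
have boxP a (j : J) : (absz (r a (val j)) * M %/ absz q < M)%N.
  by rewrite ltn_divLR ?absz_gt0 // mulnC ltn_pmul2l // r_lt.
pose box a : {ffun J -> 'I_M} := [ffun j => Ordinal (boxP a j)].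
have cardJ : #|J| = (n - e)%N.
  rewrite card_sig -[in RHS](card_ord n) -[in RHS](card_ord e).
  rewrite -(card_codom ginj).
  by rewrite -(cardC (mem (codom g))) addKn; apply: eq_card.
have /injectivePn [a [b ab Eab]] : ~~ injectiveb box.
  apply/negP => /injectiveP /leq_card.
  by rewrite card_ffun card_ord cardJ cardT leqNgt hM.
pose xx a : 'cV[int]_n := \col_j divz ((K *m y a) j 0) q.
pose rr a : 'cV[int]_n := \col_j r a j.
have Exx a' : q *: xx a' = K *m y a' - rr a'.
  apply/colP=> j; rewrite !mxE /r !mxE.
  by rewrite {2}(divz_eq (\sum_k K j k * y a' k 0) q) addrK mulrC.
exists (xx a - xx b), (rr b - rr a), (\adj A *m (y a - y b)); split.
- rewrite scalerBr !Exx mulmxA -/K mulmxBr.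
  by apply/colP=> j; rewrite !mxE; ring.
- by move=> i; rewrite !mxE !rg subrr.
- apply: contraNneq ab => rho0; apply/eqP.
  apply: (yinj _ _ (V *m (xx a - xx b))).
  have E : q *: (xx a - xx b) = N *m (\adj A *m (y a - y b)).
    rewrite scalerBr !Exx mulmxA -/K mulmxBr.
    apply/eqP; rewrite -subr_eq0 -rho0; apply/eqP/colP=> j.
    by rewrite !mxE; ring.
  have F : q *: (y a - y b) = q *: (A *m (V *m (xx a - xx b))).
    rewrite !scalemxAr E [V *m _]mulmxA VN mul1mx mulmxA mul_mx_adj.
    by rewrite mul_scalar_mx.
  apply/colP=> k; apply: (mulfI q0).
  by have := congr1 (fun u : 'cV_e => u k 0) F; rewrite /= mxE [RHS]mxE.
- move=> j; have [/codomP [i ->]|jJ] := boolP (j \in codom g).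
    by rewrite !mxE !rg subrr normr0 mul0r normr_ge0.
  have := congr1 (fun f : {ffun J -> 'I_M} => val (f (exist _ j jJ))) Eab.
  rewrite !ffunE /= !mxE => Ediv.
  have := r_ge0 a j; have := r_ge0 b j; move: (r a j) (r b j) Ediv.
  move=> [u|//] [v|//] /= Ediv _ _.
  have -> : `|v%:Z - u%:Z| * M%:Z = `|(v * M)%:Z - (u * M)%:Z|.
    by rewrite !PoszM -mulrBl normrM.
  have Q0 : (0 < `|q|)%N by rewrite absz_gt0.
  have := divn_eq (u * M) `|q|; have := divn_eq (v * M) `|q|.
  have := ltn_pmod (u * M) Q0; have := ltn_pmod (v * M) Q0.
  rewrite Ediv -abszE; move: (_ %% _)%N (_ %% _)%N (_ %/ _ * _)%N => x z k.
  by move=> hx hz -> ->; lia.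
Qed.

(** Up to column operations, q x may be replaced by rho next to N. The minor
    on the rows g and a row j equals rho j, hence some minor is nonzero; all
    minors are small because rho is. *)
Lemma adjoin_column_minors (n e : nat) (N : 'M[int]_(n, e))
    (g : 'I_e -> 'I_n) (M : nat) (x rho : 'cV[int]_n) (c : 'cV[int]_e) :
  let q := \det (rowsub g N) in
  q != 0 -> minors_le N `|q| -> q *: x = N *m c + rho ->
  (forall i, rho (g i) 0 = 0) -> rho != 0 ->
  (forall j, `|rho j 0| * M%:Z <= `|q|) ->
  (exists g', \det (rowsub g' (row_mx x N)) != 0) /\
  forall g', `|\det (rowsub g' (row_mx x N))| * M%:Z <= (1 + e)`!%:Z * `|q|.
Proof.
move=> q q0 hN Ex rho_g rho0 hrho.
have Edet (g' : 'I_(1 + e) -> 'I_n) :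
    q * \det (rowsub g' (row_mx x N)) = \det (rowsub g' (row_mx rho N)).
  have E1 : row_mx x N *m block_mx q%:M 0 0 1%:M = row_mx (q *: x) N.
    by rewrite mul_row_block !mulmx0 mulmx1 addr0 add0r mul_mx_scalar.
  have E2 : row_mx rho N *m block_mx 1%:M 0 c 1%:M = row_mx (q *: x) N.
    by rewrite mul_row_block !mulmx0 !mulmx1 add0r addrC -Ex.
  have /(congr1 (fun B => \det (rowsub g' B))) := E1; rewrite -E2 /=.
  rewrite -!mul_rowsub_mx !det_mulmx det_ublock det_lblock.
  by rewrite !det_scalar !expr1n expr1 !mulr1 mulrC.
split.
  have [j rj] : exists j, rho j 0 != 0.
    apply/existsP; apply: contraR rho0; rewrite negb_exists => /forallP r0.
    by apply/eqP/colP => j; rewrite mxE; apply/eqP; move: (r0 j); rewrite negbK.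
  pose g' (k : 'I_(1 + e)) :=
    match fintype.split k with inl _ => j | inr i => g i end.
  exists g'; suff : q * \det (rowsub g' (row_mx x N)) != 0.
    by apply: contraNneq => ->; rewrite mulr0.
  rewrite Edet.
  have -> : rowsub g' (row_mx rho N) =
      block_mx (rho j 0)%:M (row j N) 0 (rowsub g N).
    have g'l (k : 'I_1) : g' (lshift e k) = j by rewrite /g' (unsplitK (inl k)).
    have g'r (k : 'I_e) : g' (rshift 1 k) = g k.
      by rewrite /g' (unsplitK (inr k)).
    apply/matrixP=> k l; rewrite [LHS]mxE.
    case: (split_ordP k) => k' ->; case: (split_ordP l) => l' ->;
      rewrite ?g'l ?g'r.
    - by rewrite block_mxEul row_mxEl !ord1 mxE.
    - by rewrite block_mxEur row_mxEr !mxE.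
    - by rewrite block_mxEdl row_mxEl !ord1 mxE rho_g.
    - by rewrite block_mxEdr row_mxEr mxE.
  by rewrite det_ublock det_scalar expr1 mulf_neq0.
move=> g'; have q_gt0 : 0 < `|q| by rewrite normr_gt0.
rewrite -(ler_pM2l q_gt0) mulrA -normrM Edet.
case: M hrho => [|M] hrho.
  by rewrite mulr0 !mulr_ge0.
pose B : 'M[int]_(1 + e) := row_mx (M.+1%:Z *: rowsub g' rho) (rowsub g' N).
have EB : `|\det (rowsub g' (row_mx rho N))| * M.+1%:Z = `|\det B|.
  have -> : B = rowsub g' (row_mx rho N) *m block_mx M.+1%:Z%:M 0 0 1%:M.
    rewrite mul_rowsub_mx mul_row_block !mulmx0 mulmx1 addr0 add0r.
    rewrite mul_mx_scalar; apply/matrixP=> k l; rewrite !mxE.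
    by case: (fintype.split l) => l'; rewrite !mxE.
  by rewrite det_mulmx det_ublock !det_scalar expr1n expr1 mulr1 normrM.
rewrite EB.
have := @det_block_bound _ _ (fun x : int => `|x|) _ _ _ _ _ 1 e B
  (fun=> `|q|) `|q|.
rewrite big_ord1 natz mulrA [_ * `|q|]mulrC mulrA; apply.
- exact: normr0.
- exact: ler_normD.
- by move=> a b; rewrite normrM.
- exact: normrN.
- exact: normr_ge0.
- by move=> i k; rewrite row_mxEl !mxE ord1 normrM mulrC; apply: hrho.
- move=> g2; rewrite row_mxKr.
  have := hN (g' \o g2); congr (`|\det _| <= _).
  by apply/matrixP=> i k; rewrite !mxE.
Qed.

Lemma nat_root_bracket (k P : nat) : (0 < k)%N -> (1 < P)%N ->
  exists M, [/\ (0 < M)%N, (M ^ k < P)%N & (P <= (2 * M) ^ k)%N].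
Proof.
move=> k0 P1; have ex : exists M, (M ^ k < P)%N.
  by exists 0%N; rewrite exp0n // ltnW.
have ub M : (M ^ k < P)%N -> (M <= P)%N.
  case: M => // M lt; rewrite -(prednK k0) expnS in lt.
  by apply: ltnW; apply: leq_ltn_trans lt; rewrite leq_pmulr // expn_gt0.
case: (ex_maxnP ex ub) => M hM maxM; exists M.
have M0 : (0 < M)%N by apply: maxM; rewrite exp1n.
split=> //; apply: (@leq_trans (M.+1 ^ k)).
  by rewrite leqNgt; apply/negP => /maxM; rewrite ltnn.
by rewrite leq_exp2r // mul2n -addnn -addn1 leq_add2l.
Qed.

(** With P the largest minor of N, the number M of boxes per coordinate is
    taken just below the (n - e)-th root of P, so the new minors are at most a
    constant times P / M. If P = 1 there is nothing to gain from the pigeonhole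
    principle, and a basis vector outside the rows g does as well. *)
Lemma going_up_step (n e : nat) (lt_en : (e < n)%N) (N : 'M[int]_(n, e))
    (h : int) :
  left_invertible N -> minors_le N h ->
  exists (N' : 'M[int]_(n, e.+1)) (S : 'M[int]_(e.+1, e)) (h' : int),
    [/\ left_invertible N', N = N' *m S, minors_le N' h' &
      h' ^+ (n - e) <= (2 * e.+1`!)%:Z ^+ (n - e) * h ^+ (n - e.+1)].
Proof.
move=> LN hN; have [g [q0 hq]] := left_invertible_max_minor LN.
set q := \det _ in q0 hq; set k := (n - e)%N.
have k0 : (0 < k)%N by rewrite subn_gt0.
have ginj : injective g.
  move=> i j gij; apply/eqP; apply: contraNT q0 => ij; apply/eqP.
  by apply: (determinant_alternate ij) => l; rewrite !mxE gij.
have [M [x [rho [c [M0 hM [Ex rg r0 hr]]]]]] :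
  exists (M : nat) (x rho : 'cV[int]_n) (c : 'cV[int]_e),
   [/\ (0 < M)%N, (`|q| <= (2 * M) ^ k)%N &
   [/\ q *: x = N *m c + rho, forall i, rho (g i) 0 = 0, rho != 0 &
        forall j, `|rho j 0| * M%:Z <= `|q| ] ].
  have [q1|q1] := ltnP 1 `|q|.
    have [M [M0 hM1 hM2]] := nat_root_bracket k0 q1; exists M.
    have [x [rho [c [H1 H2 H3 H4]]]] := pigeonhole_remainder LN q0 M0 hM1.
    by exists x, rho, c.
  have [j jg] : exists j, j \notin codom g.
    apply/existsP; apply: contraTT lt_en; rewrite negb_exists -leqNgt.
    move=> /forallP all_g.
    rewrite -[n]card_ord -[e]card_ord -(card_codom ginj).
    apply/subset_leq_card/fintype.subsetP => i _.
    by move: (all_g i); rewrite negbK.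
  exists 1%N, (delta_mx j 0), (q *: delta_mx j 0), 0; split=> //.
    by apply: leq_trans q1 _; rewrite muln1 expn_gt0.
  split.
  - by rewrite mulmx0 add0r.
  - move=> i; rewrite !mxE (_ : g i == j = false) ?mulr0 //.
    by apply: contraNF jg => /eqP <-; apply: codom_f.
  - apply/eqP => /colP /(_ j) /eqP; rewrite !mxE !eqxx mulr1; exact/negP.
  - move=> i; rewrite mulr1 !mxE eqxx andbT normrM.
    by case: (i == j); rewrite ?normr1 ?mulr1 ?normr0 ?mulr0.
have [[g' hg'] hmin] := adjoin_column_minors q0 hq Ex rg r0 hr.
have [N' [T [LN' EN' hN']]] := saturation hg'.
have [g1 [d1 hd1]] := left_invertible_max_minor LN'.
exists N', (rsubmx T), `|\det (rowsub g1 N')|; split=> //.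
  by rewrite mulmx_rsub -EN' row_mxKr.
set h' := `|_|; set F := e.+1`!.
have h'M : h' * M%:Z <= F%:Z * `|q|.
  by apply: le_trans (hmin g1); rewrite ler_wpM2r ?hN'.
have qh : `|q| <= h by apply: hN.
have qM : `|q| <= ((2 * M) ^ k)%N%:Z by rewrite -abszE lez_nat.
have Mk0 : 0 < M%:Z ^+ k by rewrite exprn_gt0.
rewrite -(ler_pM2r Mk0) -exprMn.
apply: (@le_trans _ _ ((F%:Z * `|q|) ^+ k)).
  by rewrite lerXn2r ?nnegrE ?mulr_ge0.
have -> : (n - e.+1)%N = k.-1 by rewrite /k subnS.
rewrite exprMn -{2}(prednK k0) exprS.
apply: (@le_trans _ _ (F%:Z ^+ k * (((2 * M) ^ k)%N%:Z * h ^+ k.-1))).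
  rewrite ler_wpM2l ?exprn_ge0 //; apply: ler_pM => //; rewrite ?exprn_ge0 //.
  by rewrite lerXn2r ?nnegrE // (le_trans _ qh).
have -> : ((2 * M) ^ k)%N%:Z = 2%:Z ^+ k * M%:Z ^+ k.
  by rewrite -[LHS]natz natrX natrM exprMn !natz.
by rewrite PoszM exprMn !mulrA [_ * 2%:Z ^+ k]mulrC -!mulrA [_ * h ^+ _]mulrC.
Qed.

Lemma going_up_refl (n e : nat) : (e < n)%N ->
  exists C : int, 0 < C /\ forall (N : 'M[int]_(n, e)) (h : int),
  left_invertible N -> minors_le N h ->
  exists (N' : 'M[int]_(n, e)) (S : 'M[int]_e) (h' : int),
    [/\ left_invertible N', N = N' *m S, minors_le N' h', 0 <= h' &
      h' ^+ (n - e) <= C * h ^+ (n - e)].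
Proof.
move=> lt_en; exists 1; split=> // N h LN hN; exists N, 1%:M, h; split=> //.
- by rewrite mulmx1.
- by apply: le_trans (hN (fun i => widen_ord (ltnW lt_en) i)).
- by rewrite mul1r.
Qed.

(** The exponents telescope: (n - e - 1) / (n - e) times
    (n - e - 2) / (n - e - 1), and so on, gives (n - f) / (n - e). *)
Lemma going_up (n e f : nat) : (e <= f < n)%N ->
  exists C : int, 0 < C /\ forall (N : 'M[int]_(n, e)) (h : int),
  left_invertible N -> minors_le N h ->
  exists (N' : 'M[int]_(n, f)) (S : 'M[int]_(f, e)) (h' : int),
    [/\ left_invertible N', N = N' *m S, minors_le N' h', 0 <= h' &
      h' ^+ (n - e) <= C * h ^+ (n - f)].
Proof.
elim: f => [|f IH] /andP[le_ef lt_fn].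
  move: le_ef lt_fn; rewrite leqn0 => /eqP <- lt_en; exact: going_up_refl.
move: le_ef; rewrite leq_eqVlt => /predU1P[ef|ef].
  by move: lt_fn; rewrite -ef => lt_en; exact: going_up_refl.
have lt_fn' : (f < n)%N by apply: ltnW.
have [|C [C0 HC]] := IH; first by rewrite -ltnS ef.
have [C1 C1_gt0 EC1] : exists2 C1 : int, 0 < C1 &
    C1 = (2 * f.+1`!)%:Z ^+ (n - f).
  by eexists; last by []; rewrite exprn_gt0 // ltz_nat muln_gt0 fact_gt0.
exists (C1 ^+ (n - e) * C ^+ (n - f.+1)).
have D_gt0 : 0 < C1 ^+ (n - e) * C ^+ (n - f.+1).
  by apply: mulr_gt0; apply: exprn_gt0.
split=> // N h LN hN.
have [N1 [S1 [h1 [LN1 EN1 hN1 h1_ge0 Hh1]]]] := HC N h LN hN.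
have [N2 [S2 [h2 [LN2 EN2 hN2 Hh2]]]] := going_up_step lt_fn' LN1 hN1.
rewrite -EC1 in Hh2; have h2_ge0 : 0 <= h2.
  by apply: le_trans (hN2 (fun i => widen_ord lt_fn' i)).
have h_ge0 : 0 <= h.
  by apply: le_trans (hN (fun i => widen_ord (leq_trans (ltnW ef) lt_fn') i)).
exists N2, (S2 *m S1), h2; split=> //; first by rewrite mulmxA -EN2.
have nf_gt0 : (0 < n - f)%N by rewrite subn_gt0.
set D := C1 ^+ _ * _ in D_gt0 *.
rewrite -(ler_pXn2r nf_gt0) ?nnegrE; [|by rewrite exprn_ge0|
  by rewrite mulr_ge0 ?exprn_ge0 // ltW].
rewrite -exprM mulnC exprM exprMn.
apply: (@le_trans _ _ ((C1 * h1 ^+ (n - f.+1)) ^+ (n - e))).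
  by rewrite lerXn2r ?nnegrE ?exprn_ge0 // mulr_ge0 ?exprn_ge0 // ltW.
rewrite exprMn -exprM mulnC exprM.
apply: (@le_trans _ _ (C1 ^+ (n - e) * (C * h ^+ (n - f)) ^+ (n - f.+1))).
  rewrite ler_wpM2l ?exprn_ge0 ?(ltW C1_gt0) //.
  by rewrite lerXn2r ?nnegrE ?exprn_ge0 // mulr_ge0 ?exprn_ge0 // ltW.
rewrite exprMn mulrA -/D -[h ^+ _ ^+ _]exprM -[h ^+ _ ^+ (n - f)]exprM mulnC.
by rewrite ler_wpM2r ?exprn_ge0 // -[leLHS]expr1 ler_weXn2l.
Qed.

(** * The sine of the angle and the determinant *)

Lemma enorm_ge0 (R : realType) (I : finType) (x : I -> R) : 0 <= enorm x.
Proof. exact: sqrtr_ge0. Qed.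

Lemma ler_enorm (R : realType) (I : finType) (x : I -> R) i : `|x i| <= enorm x.
Proof.
rewrite -sqrtr_sqr ler_wsqrtr // [leRHS](bigD1 i) //= lerDl.
by apply: sumr_ge0 => j _; apply: sqr_ge0.
Qed.

Lemma enorm_le (R : realType) (I : finType) (x : I -> R) (b : R) :
  (forall i, `|x i| <= b) -> enorm x <= #|I|%:R * b.
Proof.
move=> hb; have [i0|no_i] := pickP (fun _ : I => true); last first.
  by rewrite /enorm big_pred0 // sqrtr0 eq_card0 // mul0r.
have b0 : 0 <= b by apply: le_trans (hb i0).
have cb0 : 0 <= #|I|%:R * b by rewrite mulr_ge0.
rewrite -(ger0_norm cb0) -sqrtr_sqr ler_wsqrtr //.
apply: (@le_trans _ _ (#|I|%:R * b ^+ 2)).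
  rewrite mulr_natl -sumr_const; apply: ler_sum => i _.
  by rewrite -(real_normK (num_real _)) lerXn2r ?nnegrE.
rewrite exprMn ler_wpM2r ?sqr_ge0 // expr2 ler_peMl //.
by rewrite ler1n; apply/card_gt0P; exists i0.
Qed.

Lemma vnorm_gt0 (R : realType) (n : nat) (X : 'cV[R]_n) : X != 0 -> 0 < vnorm X.
Proof.
move=> X0; rewrite lt_def enorm_ge0 andbT; apply: contraNneq X0 => nX.
apply/eqP/colP => i; rewrite mxE; apply/eqP.
by have := ler_enorm (fun i => X i 0) i; rewrite -/(vnorm X) nX normr_le0.
Qed.

Lemma ler_wedge (R : realType) (n : nat) (X Y : 'cV[R]_n) i j :
  `|X i 0 * Y j 0 - X j 0 * Y i 0| <= enorm (wedge X Y).
Proof.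
wlog lt_ij : i j / (i < j)%N => [hw|].
  have [lt|lt|/val_inj ->] := ltngtP i j; [exact: hw| |].
    by rewrite distrC; apply: hw.
  by rewrite subrr normr0 enorm_ge0.
pose p : {p : 'I_n * 'I_n | (p.1 < p.2)%N} := exist _ (i, j) lt_ij.
exact: (ler_enorm (wedge X Y) p).
Qed.

Lemma psi_ge0 (R : realType) (n : nat) (X Y : 'cV[R]_n) : 0 <= psi X Y.
Proof. by rewrite divr_ge0 ?enorm_ge0 // mulr_ge0 ?enorm_ge0. Qed.

(** Instead of the orthogonal projection of X on the line of Y, t makes the
    coordinate of X - t Y vanish where |Y| is largest. The other coordinates
    are then coordinates of the wedge product divided by that entry of Y, and
    the price is only a factor n. *)
Lemma psi_distance (R : realType) (n : nat) (X Y : 'cV[R]_n) :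
  X != 0 -> Y != 0 ->
  exists t : R, forall i, `|(X - t *: Y) i 0| <= n%:R * psi X Y * vnorm X.
Proof.
move=> X0 Y0.
have [i0 Yi0] : exists i, Y i 0 != 0.
  apply/existsP; apply: contraR Y0; rewrite negb_exists => /forallP y0.
  by apply/eqP/colP => j; rewrite mxE; apply/eqP; move: (y0 j); rewrite negbK.
case: (@arg_maxP _ R _ i0 xpredT (fun i => `|Y i 0|) isT) => j _ jmax.
have Yj0 : 0 < `|Y j 0| by apply: lt_le_trans (jmax i0 isT); rewrite normr_gt0.
exists (X j 0 / Y j 0) => i.
have nX := vnorm_gt0 X0; have nY := vnorm_gt0 Y0.
have -> : (X - (X j 0 / Y j 0) *: Y) i 0 =
    (X i 0 * Y j 0 - X j 0 * Y i 0) / Y j 0.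
  by rewrite !mxE; field; rewrite -normr_gt0.
rewrite normrM normfV ler_pdivrMr //.
apply: le_trans (ler_wedge X Y i j) _.
have -> : enorm (wedge X Y) = psi X Y * vnorm X * vnorm Y.
  by rewrite /psi -mulrA divfK // mulf_neq0 // gt_eqF.
move: (psi X Y) (psi_ge0 X Y) => s s0.
rewrite [n%:R * _]mulrC -!mulrA; apply: ler_wpM2l => //.
rewrite mulrCA; apply: ler_wpM2l; first exact: ltW.
have := @enorm_le R _ (fun i => Y i 0) `|Y j 0|; rewrite card_ord; apply=> k.
exact: jmax.
Qed.

(** Let Z = X - t Y be the short vector of [psi_distance]. As Z is (G | N)
    applied to a vector with k-th entry a_k, replacing column k of G by Z
    multiplies the determinant by a_k, by Cramer's rule. If a_k is the largest
    entry of a, it is comparable to the norm of X = G a. *)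
Lemma psi_det_bound (R : realType) (d f : nat) (G : 'M[R]_(d + f, d)) :
  exists C : R, 0 < C /\ forall (N : 'M[R]_(d + f, f)) (H : R)
    (a : 'cV[R]_d) (y : 'cV[R]_f),
  (forall g : 'I_f -> 'I_(d + f), `|\det (rowsub g N)| <= H) ->
  G *m a != 0 -> N *m y != 0 ->
  `|\det (row_mx G N)| <= C * psi (G *m a) (N *m y) * H.
Proof.
pose gam : R := 1 + \sum_i \sum_j `|G i j|.
have Ggam i j : `|G i j| <= gam.
  rewrite /gam (bigD1 i) //= (bigD1 j) //= addrCA -!addrA lerDl.
  rewrite addr_ge0 ?sumr_ge0 // addr_ge0 // ?ler01 //.
  by apply: sumr_ge0 => k _; apply: sumr_ge0.
have gam_gt0 : 0 < gam.
  by apply: ltr_pwDl => //; apply: sumr_ge0 => k _; apply: sumr_ge0.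
set n := (d + f)%N.
(* the summand 1 keeps C positive *)
pose C : R := n`!%:R * (n%:R * (n%:R * (d%:R * gam)) + 1) * gam ^+ d.
exists C; split.
  rewrite mulr_gt0 ?exprn_gt0 // mulr_gt0 ?ltr0n ?fact_gt0 //.
  by rewrite ltr_wpDl // !mulr_ge0 // ltW.
move=> N H a y hN X0 Y0; set X := G *m a in X0 *; set Y := N *m y in Y0 *.
have [k0 ak0] : exists k, a k 0 != 0.
  apply/existsP; apply: contraR X0; rewrite negb_exists => /forallP a0.
  rewrite /X (_ : a = 0) ?mulmx0 //.
  by apply/colP => j; rewrite mxE; apply/eqP; move: (a0 j); rewrite negbK.
case: (@arg_maxP _ R _ k0 xpredT (fun i => `|a i 0|) isT) => k _ kmax.
have ak_gt0 : 0 < `|a k 0|.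
  by apply: lt_le_trans (kmax k0 isT); rewrite normr_gt0.
have [t ht] := psi_distance X0 Y0; set Z := X - t *: Y in ht.
set M := row_mx G N; pose u := col_mx a (- t *: y).
have Mu : M *m u = Z by rewrite mul_row_col -scalemxAr scaleNr.
have adjZ : (\adj M *m Z) (lshift f k) 0 = \det M * a k 0.
  by rewrite -Mu mulmxA mul_adj_mx mul_scalar_mx mxE col_mxEu.
have nX : vnorm X <= n%:R * (d%:R * gam * `|a k 0|).
  have := @enorm_le R _ (fun i => X i 0) (d%:R * gam * `|a k 0|).
  rewrite card_ord; apply=> i; rewrite mxE.
  apply: le_trans (ler_norm_sum _ _ _) _.
  rewrite -mulrA mulr_natl -[X in _ *+ X](card_ord d) -sumr_const.
  apply: ler_sum => j _; rewrite normrM; apply: ler_pM => //.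
  exact: kmax.
pose z := n%:R * psi X Y * vnorm X.
pose p (j : 'I_d) := (if j == k then z else 1) * gam.
have z_ge0 : 0 <= z 
  by apply: mulr_ge0; [rewrite mulr_ge0 // psi_ge0|exact: enorm_ge0].
have gam1 : 1 <= gam.
  by rewrite lerDl; apply: sumr_ge0 => i _; apply: sumr_ge0.
have H0 : 0 <= H by apply: le_trans (hN (@rshift d f)).
have prodp : \prod_j p j = z * gam ^+ d.
  rewrite big_split /= prodr_const card_ord; congr (_ * _).
  by rewrite (bigD1 k) //= eqxx big1 ?mulr1 // => j /negbTE ->.
have le1 : `|\det M| * `|a k 0| <= n`!%:R * (z * gam ^+ d) * H.
  rewrite -normrM -adjZ -det_replace_column -prodp.
  apply: (@det_block_bound _ _ (fun x : R => `|x|)).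
  - exact: normr0.
  - exact: ler_normD.
  - by move=> x w; rewrite normrM.
  - exact: normrN.
  - exact: normr_ge0.
  - move=> i j; rewrite mxE /p (inj_eq (@lshift_inj _ _)).
    case: eqP => _; last by rewrite mul1r row_mxEl.
    by apply: le_trans (ht i) _; rewrite ler_peMr.
  - move=> g; have := hN g; congr (`|\det _| <= _).
    apply/matrixP=> i j; rewrite !mxE.
    by rewrite [rshift d j == _]eq_sym eq_lrshift (unsplitK (inr j)).
rewrite -(ler_pM2r ak_gt0); apply: le_trans le1 _.
have zle : z <= (n%:R * (n%:R * (d%:R * gam)) : R) * psi X Y * `|a k 0|.
  rewrite /z; move: (psi X Y) (psi_ge0 X Y) => s s0.
  have -> : (n%:R * (n%:R * (d%:R * gam)) * s * `|a k 0| : R) =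
     n%:R * s * (n%:R * (d%:R * gam * `|a k 0|)) by ring.
  by rewrite ler_wpM2l // mulr_ge0.
move: (psi X Y) (psi_ge0 X Y) zle => s s0 zle.
rewrite /C; move: (n%:R * (n%:R * (d%:R * gam)) : R) zle => q zle.
have -> : n`!%:R * (q + 1) * gam ^+ d * s * H * `|a k 0| =
  n`!%:R * ((q * s * `|a k 0| + s * `|a k 0|) * gam ^+ d) * H by ring.
rewrite ler_wpM2r // ler_wpM2l // ler_wpM2r ?exprn_ge0 ?(ltW gam_gt0) //.
by apply: le_trans zle _; rewrite lerDl mulr_ge0.
Qed.

(** * Rational subspaces and their heights *)

(** The columns of M form a basis of B; stated through products, so that a
    change of basis is an invertible factor. *)
Definition column_space (K : fieldType) (n e : nat) (B : {vspace 'cV[K]_n})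
    (M : 'M[K]_(n, e)) :=
  (forall X, X \in B <-> exists y : 'cV[K]_e, X = M *m y) /\
  (forall y : 'cV[K]_e, M *m y = 0 -> y = 0).

Lemma mulmx_sum_col (K : fieldType) (n e : nat) (M : 'M[K]_(n, e))
    (y : 'cV[K]_e) :
  M *m y = \sum_j y j 0 *: col j M.
Proof.
apply/colP=> i; rewrite mxE summxE; apply: eq_bigr => j _.
by rewrite !mxE mulrC.
Qed.

Lemma free_columns (K : fieldType) (n e : nat) (M : 'M[K]_(n, e)) :
  (forall y : 'cV[K]_e, M *m y = 0 -> y = 0) ->
  free [seq col j M | j : 'I_e].
Proof.
move=> inj; rewrite -[image_mem _ _]/(tval [tuple col j M | j < e]).
apply/freeP => k; rewrite (_ : \sum_i _ = M *m (\col_j k j)); last first.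
  rewrite mulmx_sum_col; apply: eq_bigr => j _.
  by rewrite mxE -tnth_nth tnth_mktuple.
by move=> /inj /colP k0 j; have := k0 j; rewrite !mxE.
Qed.

Lemma basis_column_space (K : fieldType) (n e : nat) (B : {vspace 'cV[K]_n})
    (M : 'M[K]_(n, e)) :
  basis_of B [seq col j M | j : 'I_e] <-> column_space B M.
Proof.
pose t := [tuple col j M | j < e].
have tE : [seq col j M | j : 'I_e] = t :> seq _ by [].
have nth_t (j : 'I_e) : t`_j = col j M by rewrite -tnth_nth tnth_mktuple.
have sumE (y : 'cV[K]_e) : M *m y = \sum_(j < e) y j 0 *: t`_j.
  by rewrite mulmx_sum_col; apply: eq_bigr => j _; rewrite nth_t.
rewrite tE; split=> [/andP[/eqP spanB /freeP freet]|[memB inj]].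
  split=> [X|y]; last first.
    rewrite sumE => /(freet (fun j => y j 0)) y0.
    by apply/colP=> j; rewrite mxE y0.
  rewrite -spanB; split=> [/coord_span EX|[y ->]].
    exists (\col_j coord t j X); rewrite sumE [LHS]EX.
    by apply: eq_bigr => j _; rewrite mxE.
  rewrite sumE; apply: memv_suml => j _; apply: memvZ; apply: memv_span.
  by rewrite mem_nth ?size_tuple.
apply/andP; split; last by apply: free_columns.
rewrite eqEsubv; apply/andP; split.
  apply/span_subvP => X /tnthP [j ->]; rewrite tnth_mktuple; apply/memB.
  by exists (delta_mx j 0); rewrite -colE.
apply/subvP => X /memB [y ->]; rewrite sumE.
apply: memv_suml => j _; apply: memvZ; apply: memv_span.
by rewrite mem_nth ?size_tuple.
Qed.

Lemma column_space_minor_neq0 (K : fieldType) (n e : nat) (M : 'M[K]_(n, e)) :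
  (forall y : 'cV[K]_e, M *m y = 0 -> y = 0) ->
  exists g : 'I_e -> 'I_n, \det (rowsub g M) != 0.
Proof.
move=> inj.
have fullM : row_full M.
  rewrite /row_full -mxrank_tr; change (row_free M^T).
  rewrite -kermx_eq0; apply/eqP/row_matrixP => i; rewrite row0.
  have : row i (kermx M^T) *m M^T = 0 by apply/sub_kermxP; apply: row_sub.
  move=> /(congr1 trmx); rewrite trmx_mul trmxK trmx0 => /inj /(congr1 trmx).
  by rewrite trmxK trmx0.
exists (fullrankfun fullM); rewrite -unitfE -[_ \is a _]/(_ \in unitmx).
by rewrite -row_full_unit -/(row_full _); apply: fullrowsub_full.
Qed.

Lemma column_space_mulmx (K : fieldType) (n e : nat) (B : {vspace 'cV[K]_n})
    (M N : 'M[K]_(n, e)) (Q : 'M[K]_e) :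
  M = N *m Q -> Q \in unitmx -> column_space B M -> column_space B N.
Proof.
move=> EM uQ [memB inj]; split=> [X|y Ny].
  split=> [/memB [y ->]|[y ->]]; first by exists (Q *m y); rewrite EM mulmxA.
  by apply/memB; exists (invmx Q *m y); rewrite EM mulmxA mulmxK.
have := inj (invmx Q *m y); rewrite EM mulmxA mulmxK // => /(_ Ny).
by move=> /(congr1 (mulmx Q)); rewrite mulKVmx // mulmx0.
Qed.

Lemma column_space_uniq (K : fieldType) (n e : nat) (B : {vspace 'cV[K]_n})
    (M N : 'M[K]_(n, e)) :
  column_space B M -> column_space B N ->
  exists2 Q : 'M[K]_e, Q \in unitmx & N = M *m Q.
Proof.
move=> [memM injM] [memN injN].
have colN j : exists y : 'cV[K]_e, col j N = M *m y.
  by apply/memM/memN; exists (delta_mx j 0); rewrite -colE.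
have [q hq] := choice colN.
pose Q := \matrix_(i, j) q j i 0.
have EN : N = M *m Q.
  apply/matrixP=> i j; have := congr1 (fun c : 'cV[K]_n => c i 0) (hq j).
  by rewrite !mxE => ->; apply: eq_bigr => k _; rewrite !mxE.
exists Q => //; rewrite unitmxE unitfE -det_tr; apply/negP => /det0P [v v0 vQ].
move/eqP: v0; apply; apply: trmx_inj; rewrite trmx0; apply: injN.
have /(congr1 trmx) := vQ; rewrite trmx_mul trmxK trmx0 EN -mulmxA => ->.
by rewrite mulmx0.
Qed.

Lemma rational_space_int_matrix (R : realType) (n e : nat)
    (B : {vspace 'cV[R]_n}) :
  rational_space e B ->
  exists2 N : 'M[int]_(n, e), left_invertible N &
    column_space B (map_mx intr N : 'M[R]_(n, e)).
Proof.
move=> [b basisB].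
pose Mq : 'M[rat]_(n, e) := \matrix_(i, j) tnth b j i 0.
have spanB : column_space B (map_mx ratr Mq : 'M[R]_(n, e)).
  apply/basis_column_space; move: basisB; congr (basis_of B _).
  rewrite -[X in map _ X](map_tnth_enum b) -map_comp; apply: eq_map => j /=.
  by apply/colP=> i; rewrite !mxE.
move: Mq spanB => Mq spanB.
(* a common denominator of the entries *)
pose k : int := \prod_(p : 'I_n * 'I_e) denq (Mq p.1 p.2).
have k0 : k != 0 by apply/prodf_neq0 => p _; apply: denq_neq0.
have [Mz EMz] : exists Mz : 'M[int]_(n, e), map_mx intr Mz = k%:~R *: Mq.
  exists (\matrix_(i, j) (numq (Mq i j) *
     \prod_(p : 'I_n * 'I_e | p != (i, j)) denq (Mq p.1 p.2))).
  apply/matrixP=> i j; rewrite !mxE /k [in RHS](bigD1 (i, j)) //= !intrM.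
  by rewrite numqE; ring.
have EMzR : map_mx intr Mz = k%:~R *: map_mx ratr Mq :> 'M[R]_(n, e).
  apply/matrixP=> i j.
  have := congr1 (fun A : 'M[rat]_(n, e) => ratr (A i j) : R) EMz.
  by rewrite !mxE rmorphM /= !ratr_int.
have spanMz : column_space B (map_mx intr Mz : 'M[R]_(n, e)).
  apply: (column_space_mulmx (Q := (k%:~R^-1)%:M) _ _ spanB).
    by rewrite mul_mx_scalar EMzR scalerA mulVf ?scale1r // intr_eq0.
  by rewrite unitmxE det_scalar unitrX // unitrV unitfE intr_eq0.
have [g] := column_space_minor_neq0 spanMz.2.
rewrite -map_mxsub det_map_mx intr_eq0 => hg.
have [N [T [LN EN _]]] := saturation hg.
exists N => //; apply: (column_space_mulmx (Q := map_mx intr T) _ _ spanMz).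
  by rewrite EN map_mxM.
rewrite unitmxE unitfE det_map_mx intr_eq0.
by apply: contraNneq hg => T0; rewrite EN -mul_rowsub_mx det_mulmx T0 mulr0.
Qed.

(** The gcd of the maximal minors of N divides every term of the expansion of
    det (V N) = 1. *)
Lemma primitive_plucker_minors (R : realType) (n e : nat)
    (B : {vspace 'cV[R]_n}) (N : 'M[int]_(n, e)) :
  left_invertible N -> column_space B (map_mx intr N : 'M[R]_(n, e)) ->
  primitive_plucker B
    (fun f : row_choice n e => \det (rowsub (fun i => val f i) N)).
Proof.
move=> [V VN] spanB; split.
  exists (map_mx intr N); first exact/basis_column_space.
  exists 1; first exact: oner_neq0.
  by move=> f; rewrite mul1r /minor -map_mxsub det_map_mx.
set D := \big[gcdn/0%N]_f _.
have dvdD (g : 'I_e -> 'I_n) : (D%:Z %| \det (rowsub g N))%Z.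
  have [->|[f [s ->]]] := det_rowsub_sorted int g; first exact: dvdz0.
  by rewrite dvdz_mull // /D (bigD1 f) //= dvdzE dvdn_gcdl.
have : (D%:Z %| \det (V *m N))%Z.
  by rewrite det_mulmx_rowsub; apply: rpred_sum => g _; rewrite dvdz_mull.
by rewrite VN det1 dvdz1 => /eqP.
Qed.

Lemma ler_norm_intM (K : numDomainType) (m a : int) :
  1 <= `|m| -> `|a|%:~R <= `|m%:~R * a%:~R : K|.
Proof. by move=> m1; rewrite -intrM -intr_norm ler_int normrM ler_peMl. Qed.

(** Any primitive Plücker vector is proportional to the minors of N. The factor
    is an integer, since it is itself a combination of the entries of the
    vector by the expansion of det (V N) = 1; so it cannot shrink the minors. *)
Lemma minors_le_primitive_plucker (R : realType) (n e : nat)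
    (B : {vspace 'cV[R]_n}) (N : 'M[int]_(n, e)) (Xi : row_choice n e -> int) :
  left_invertible N -> column_space B (map_mx intr N : 'M[R]_(n, e)) ->
  primitive_plucker B Xi ->
  forall g, `|\det (rowsub g N)|%:~R <= enorm (fun f => (Xi f)%:~R : R).
Proof.
move=> [V VN] spanB [[M /basis_column_space spanM [c c0 Ec]] _].
have [Q uQ EN] := column_space_uniq spanM spanB.
have dQ : \det Q != 0 by rewrite -unitfE -unitmxE.
pose k := c / \det Q.
have k0 : k != 0 by rewrite mulf_neq0 ?invr_neq0.
have EXi f : (Xi f)%:~R = k * (\det (rowsub (fun i => val f i) N))%:~R :> R.
  rewrite Ec -det_map_mx map_mxsub EN -mul_rowsub_mx det_mulmx /minor /k.
  by rewrite [_ * \det Q]mulrC mulrA divfK.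
have intk (g : 'I_e -> 'I_n) :
    exists z : int, k * (\det (rowsub g N))%:~R = z%:~R.
  have [->|[f [s ->]]] := det_rowsub_sorted int g.
    by exists 0; rewrite mulr0.
  exists ((-1) ^+ s * Xi f); rewrite !rmorphM /= mulrCA EXi.
  by rewrite rmorphXn rmorphN1.
have [z hz] := choice intk.
have [m Em] : exists m : int, k = m%:~R.
  exists (\sum_(g : {ffun 'I_e -> 'I_n}) (\prod_i V i (g i)) * z g).
  have E1 := congr1 (intr : int -> R) (det_mulmx_rowsub V N).
  rewrite VN det1 in E1; rewrite -[LHS]mulr1 -[X in _ * X]/(1%:~R : R) E1.
  rewrite !rmorph_sum mulr_sumr; apply: eq_bigr => g _.
  by rewrite !rmorphM /= mulrCA hz.
have m1 : 1 <= `|m|.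
  by rewrite -gtz0_ge1 normr_gt0; move: k0; rewrite Em intr_eq0.
move=> g; have [->|[f [s ->]]] := det_rowsub_sorted int g.
  by rewrite normr0 enorm_ge0.
apply: le_trans (ler_enorm (fun f => (Xi f)%:~R : R) f).
by rewrite EXi Em normrM normrX normrN1 expr1n mul1r; apply: ler_norm_intM.
Qed.

Lemma rational_space_height (R : realType) (n e : nat) (B : {vspace 'cV[R]_n}) :
  rational_space e B ->
  exists N : 'M[int]_(n, e), [/\ left_invertible N,
    column_space B (map_mx intr N : 'M[R]_(n, e)) &
    forall g, `|\det (rowsub g N)|%:~R <= height B].
Proof.
move=> ratB; have dimB : \dim B = e.
  by case: ratB => b /size_basis.
have [N LN spanB] := rational_space_int_matrix ratB.
exists N; split=> //; move: N LN spanB; rewrite -dimB => N LN spanB.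
rewrite /height; set P := [set h | _]%classic.
have : P (xget 0 P).
  apply: (@xgetI _ 0 _ (enorm (fun f : row_choice n (\dim B) =>
     (\det (rowsub (fun i => val f i) N))%:~R : R))).
  exists (fun f : row_choice n (\dim B) =>
    \det (rowsub (fun i => val f i) N)) => //.
  exact: primitive_plucker_minors.
by move=> [Xi prim ->]; apply: minors_le_primitive_plucker prim.
Qed.

Lemma column_space_minors_inj (K : fieldType) (n e : nat)
    (B B' : {vspace 'cV[K]_n}) (M M' : 'M[K]_(n, e)) :
  column_space B M -> column_space B' M' ->
  (forall g : 'I_e -> 'I_n, \det (rowsub g M) = \det (rowsub g M')) -> B = B'.
Proof.
move=> spanB spanB' eqM; have [g dg] := column_space_minor_neq0 spanB.2.
have uM : rowsub g M \in unitmx by rewrite unitmxE unitfE.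
have uM' : rowsub g M' \in unitmx by rewrite unitmxE unitfE -eqM.
have E : M *m \adj (rowsub g M) = M' *m \adj (rowsub g M').
  by apply/matrixP=> i j; rewrite !mulmx_adj_rowsub eqM.
have Minv (L : 'M[K]_(n, e)) : rowsub g L \in unitmx ->
    L = (L *m \adj (rowsub g L)) *m ((\det (rowsub g L))^-1 *: rowsub g L).
  move=> uL; rewrite -mulmxA -scalemxAr mul_adj_mx scale_scalar_mx.
  by rewrite mulVf ?mulmx1 // -unitfE -unitmxE.
have uS (L : 'M[K]_e) : L \in unitmx -> (\det L)^-1 *: L \in unitmx.
  by move=> uL; rewrite unitmxZ // unitrV -unitmxE.
have s1 := column_space_mulmx (Minv M uM) (uS _ uM) spanB.
have s2 := column_space_mulmx (Minv M' uM') (uS _ uM') spanB'.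
rewrite -E in s2; apply/vspaceP => X.
by apply/idP/idP => [/s1.1/s2.1|/s2.1/s1.1].
Qed.

(** A rational subspace of bounded height is determined by the minors of an
    integer matrix, and these take finitely many values. *)
Lemma finite_bounded_height (R : realType) (n e : nat) (h : R) :
  finite_set [set B : {vspace 'cV[R]_n} |
    rational_space e B /\ height B <= h]%classic.
Proof.
pose K := `|Num.ceil h|%N.
pose I := {ffun 'I_e -> 'I_n}.
(* phi lists the minors shifted by K, so that they become natural numbers *)
pose good (phi : {ffun I -> 'I_(2 * K).+1}) (B : {vspace 'cV[R]_n}) :=
  exists2 N : 'M[int]_(n, e), column_space B (map_mx intr N : 'M[R]_(n, e)) &
    forall g : I, \det (rowsub g N) = (phi g)%:Z - K%:Z.
pose F phi := xget 0%VS [set B | good phi B]%classic.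
apply: (@sub_finite_set _ _ (F @` setT)%classic); last first.
  by apply: finite_image; exact: finite_finset.
move=> B [/rational_space_height [N [LN spanB hN]] hB].
have bound g : `|\det (rowsub g N)| <= K%:Z.
  have := le_trans (hN g) hB; move=> hg.
  have h0 : 0 <= h by apply: le_trans hg; rewrite ler0z.
  rewrite /K gez0_abs ?ceil_ge0 //; last first.
    by apply: lt_le_trans h0; rewrite ltrN10.
  by rewrite -(ler_int R); apply: le_trans hg (ceil_ge _).
have lt_phi (g : I) : (`|(\det (rowsub g N) + K%:Z)%R| < (2 * K).+1)%N.
  by move: (bound g); lia.
pose phi : {ffun I -> 'I_(2 * K).+1} := [ffun g => Ordinal (lt_phi g)].
have goodB : good phi B.
  exists N => // g; rewrite ffunE /=; move: (bound g); lia.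
exists phi => //; rewrite /F.
have : good phi (F phi) by apply: (@xgetI _ 0%VS _ B).
move=> [N' spanF hN']; case: goodB => N2 spanB2 hN2.
apply: (column_space_minors_inj spanF spanB2) => g.
rewrite -!map_mxsub !det_map_mx; congr (_%:~R).
have := hN' [ffun i => g i]; have := hN2 [ffun i => g i].
have Eg (L : 'M[int]_(n, e)) : rowsub [ffun i => g i] L = rowsub g L.
  by apply/matrixP=> i j; rewrite !mxE ffunE.
by rewrite !Eg => -> ->.
Qed.

(** * The exponent of the moment subspace *)

Definition moment_space (R : realType) (n d : nat) (theta : R) :
    {vspace 'cV[R]_n} :=
  <<[seq col j (map_mx (horner_eval theta \o map_poly intr) (moment_mx n d)) |
      j : 'I_d]>>%VS.

Lemma horner_moment_det (R : rcfType) (d f : nat) (theta : R)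
    (N : 'M[int]_(d + f, f)) :
  (map_poly intr (moment_det N)).[theta] =
  \det (row_mx
    (map_mx (horner_eval theta \o map_poly intr) (moment_mx (d + f) d))
    (map_mx intr N)).
Proof.
pose ev : {rmorphism {poly int} -> R} :=
  horner_eval theta \o map_poly (intr : int -> R).
change (ev (moment_det N) =
  \det (row_mx (map_mx ev (moment_mx (d + f) d)) (map_mx intr N))).
rewrite -det_map_mx map_row_mx; congr (\det (row_mx _ _)).
by apply/matrixP=> i j; rewrite !mxE /ev /= map_polyC /horner_eval hornerC.
Qed.

Lemma psi_space_ge (R : realType) (n : nat) (A B : {vspace 'cV[R]_n}) (r : R) :
  A != 0%VS -> B != 0%VS ->
  (forall X Y, X \in A -> X != 0 -> Y \in B -> Y != 0 -> r <= psi X Y) ->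
  r <= psi_space A B 1.
Proof.
move=> A0 B0 hr; rewrite /psi_space /min_psi /=; apply: lb_le_inf.
  exists (psi (vpick A) (vpick B)), (vpick A, vpick B) => //.
  by split; rewrite ?memv_pick ?vpick0.
by move=> _ [[X Y] [/= XA X0 YB Y0 _] <-]; apply: hr.
Qed.

Lemma powR_root (R : realType) (s x : R) (k : nat) :
  0 <= s -> 0 <= x -> (0 < k)%N ->
  x <= s ^+ k -> x `^ (k%:R^-1) <= s.
Proof.
move=> s0 x0 k0 le_x.
have -> : s = (s ^+ k) `^ (k%:R^-1).
  by rewrite -powR_mulrn // -powRrM mulfV ?powRr1 // pnatr_eq0 -lt0n.
by apply: ge0_ler_powR; rewrite ?nnegrE ?invr_ge0 // exprn_ge0.
Qed.

(** For B of dimension d - 1, going up to dimension f and combining the two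
    estimates of D_N (theta) bounds the angle below. The same inclusion shows
    that A meets B trivially, as A and the larger subspace are complementary. *)
Lemma moment_space_psi_bound (R : realType) (d f : nat) :
  (1 < d)%N -> (d <= f)%N ->
  exists A : {vspace 'cV[R]_(d + f)},
    [/\ irrational_space d d.-1 1 A &
     exists2 kappa : R, 0 < kappa & forall B, rational_space d.-1 B ->
       1 <= height B /\
       forall X Y, X \in A -> X != 0 -> Y \in B -> Y != 0 ->
       kappa <= psi X Y ^+ f.+1 * height B ^+ (d * (d + f))].
Proof.
move=> d1 df; set e := d.-1; have Ed : d = e.+1 by rewrite prednK // ltnW.
have n0 : (0 < d + f)%N by rewrite addn_gt0 (ltnW d1).
have [theta [c [c0 Hc]]] := @moment_det_lower_bound R d f n0.
pose G : 'M[R]_(d + f, d) :=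
  map_mx (horner_eval theta \o map_poly intr) (moment_mx (d + f) d).
have detG (N : 'M[int]_(d + f, f)) :
    left_invertible N -> \det (row_mx G (map_mx intr N)) != 0.
  move=> LN; have [g [_ hg]] := left_invertible_max_minor LN.
  case: (LN) => V VN.
  have := Hc N V `|\det (rowsub g N)|%:~R VN.
  rewrite horner_moment_det -/G => H; apply: contraTneq c0 => D0.
  rewrite -leNgt; apply: le_trans (H _) _.
    by move=> g'; rewrite ler_int hg.
  by rewrite D0 normr0 mul0r.
have capG (N : 'M[int]_(d + f, f)) (a : 'cV[R]_d) (y : 'cV[R]_f) :
    left_invertible N -> G *m a = map_mx intr N *m y -> a = 0.
  move=> LN E; have := detG N LN.
  rewrite -unitfE -[_ \is a _]/(_ \in unitmx) => uM.
  have : row_mx G (map_mx intr N) *m col_mx a (- y) = 0.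
    by rewrite mul_row_col E mulmxN subrr.
  move=> /(congr1 (mulmx (invmx (row_mx G (map_mx intr N))))).
  rewrite mulKmx // mulmx0 => /(congr1 usubmx).
  by rewrite col_mxKu; move=> ->; apply/matrixP=> i j; rewrite !mxE.
have LN0 : left_invertible (col_mx 0 1%:M : 'M[int]_(d + f, f)).
  by exists (row_mx 0 1%:M); rewrite mul_row_col mul0mx add0r mulmx1.
pose A := moment_space (d + f) d theta.
have freeG (a : 'cV[R]_d) : G *m a = 0 -> a = 0.
  by move=> Ga; apply: (capG _ a 0 LN0); rewrite Ga mulmx0.
have spanA : column_space A G.
  by apply/basis_column_space; rewrite /basis_of eqxx free_columns.
have dimA : \dim A = d.
  by have /eqP := free_columns freeG; rewrite size_image card_ord.
have [|C1 [C10 HC1]] := @going_up (d + f) e f; first by lia.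
(* N1 spans a rational subspace of dimension f that contains B *)
have up (B : {vspace 'cV[R]_(d + f)}) : rational_space e B ->
   exists (N1 : 'M[int]_(d + f, f)) (h1 : int),
   [/\ left_invertible N1, minors_le N1 h1, 0 <= h1,
     1 <= height B /\ (h1 ^+ f.+1)%:~R <= C1%:~R * height B ^+ d &
     forall Y, Y \in B -> exists y, Y = map_mx intr N1 *m y].
  move=> /rational_space_height [N [LN spanB hN]].
  have [g [g0 hg]] := left_invertible_max_minor LN.
  have [N1 [S [h1 [LN1 EN1 hN1 h1_ge0 hh1]]]] := HC1 N _ LN hg.
  exists N1, h1; split=> //; last first.
    move=> Y /spanB.1 [y ->]; exists (map_mx intr S *m y).
    by rewrite mulmxA -map_mxM -EN1.
  split.
    apply: le_trans (hN g); rewrite -[1]/(1%:~R) ler_int.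
    by rewrite -gtz0_ge1 normr_gt0.
  have -> : f.+1 = (d + f - e)%N by lia.
  apply: (@le_trans _ _ (C1 * `|\det (rowsub g N)| ^+ (d + f - f))%:~R).
    by rewrite ler_int.
  rewrite addnK intrM rmorphXn /= ler_wpM2l ?ler0z ?(ltW C10) //.
  by rewrite lerXn2r ?nnegrE ?hN // ?ler0z // (le_trans _ (hN g)) ?ler0z.
exists A; split.
  split=> // B ratB; have [N1 [h1 [LN1 _ _ _ spanB]]] := up B ratB.
  suff -> : (A :&: B)%VS = 0%VS by rewrite dimv0.
  apply/eqP; rewrite -subv0; apply/subvP => X; rewrite memv_cap memv0.
  move=> /andP[/spanA.1 [a ->] /spanB [y Ey]].
  by rewrite (capG N1 a y) // mulmx0.
have [C2 [C20 HC2]] := psi_det_bound G.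
pose C1r : R := C1%:~R; have C1r0 : 0 < C1r by rewrite ltr0z.
exists (c ^+ f.+1 / (C2 ^+ f.+1 * C1r ^+ (d + f))).
  by rewrite divr_gt0 ?exprn_gt0 // mulr_gt0 ?exprn_gt0.
move=> B ratB; have [N1 [h1 [LN1 hN1 h1_ge0 [ht1 hh1] spanB]]] := up B ratB.
split=> // X Y /spanA.1 [a ->] X0 /spanB [y ->] Y0.
set s := psi _ _; have s0 : 0 <= s by apply: psi_ge0.
have ht0 : 0 <= height B by apply: le_trans ht1.
have [V VN1] := LN1.
have h1r_ge0 : 0 <= h1%:~R :> R by rewrite ler0z.
have le1 : c <= C2 * s * h1%:~R ^+ (d + f).
  have le2 : `|\det (row_mx G (map_mx intr N1))| <= C2 * s * h1%:~R.
    apply: HC2 => // g; rewrite -map_mxsub det_map_mx -intr_norm ler_int.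
    exact: hN1.
  apply: le_trans (Hc N1 V h1%:~R VN1 _) _.
    by move=> g; rewrite ler_int.
  have -> : h1%:~R ^+ (d + f) = h1%:~R * h1%:~R ^+ (d + f).-1 :> R.
    by rewrite -exprS prednK.
  rewrite horner_moment_det -/G mulrA.
  by rewrite ler_wpM2r // exprn_ge0.
clearbody s.
rewrite ler_pdivrMr; last by rewrite mulr_gt0 ?exprn_gt0.
apply: (@le_trans _ _ ((C2 * s * h1%:~R ^+ (d + f)) ^+ f.+1)).
  by rewrite lerXn2r ?nnegrE ?(ltW c0) // !mulr_ge0 ?exprn_ge0 // ltW.
have -> : s ^+ f.+1 * height B ^+ (d * (d + f)) *
    (C2 ^+ f.+1 * C1r ^+ (d + f)) =
  C2 ^+ f.+1 * s ^+ f.+1 * (C1r * height B ^+ d) ^+ (d + f).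
  by rewrite exprMn -exprM; ring.
have -> : (C2 * s * h1%:~R ^+ (d + f)) ^+ f.+1 =
    C2 ^+ f.+1 * s ^+ f.+1 * (h1 ^+ f.+1)%:~R ^+ (d + f).
  by rewrite !exprMn rmorphXn /= -!exprM mulnC.
apply: ler_wpM2l; first by rewrite mulr_ge0 ?exprn_ge0 // ltW.
rewrite lerXn2r ?nnegrE ?ler0z ?exprn_ge0 // mulr_ge0 ?exprn_ge0 //.
exact: ltW.
Qed.

Lemma exponent_le (R : realType) (d f : nat) : (1 < d)%N -> (d <= f)%N ->
  (d * (d + f))%:R / f.+1%:R <= (2 * d%:R ^+ 2) / (d%:R + 1) :> R.
Proof.
move=> d1 df; rewrite ler_pdivrMr ?ltr0n // mulrAC ler_pdivlMr ?ltr_wpDl //.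
have -> : (d%:R + 1 : R) = d.+1%:R by rewrite -natr1.
rewrite -natrX -!natrM ler_nat -(subnKC df); move: (f - d)%N => k.
have dk : (k <= d * k)%N by rewrite leq_pmull // ltnW.
have : (d * ((d + (d + k)) * d.+1) <= d * (2 * d * (d + k).+1))%N.
  by rewrite leq_mul2l; apply/orP; right; lia.
by rewrite -mulnn; lia.
Qed.

(** If b exceeds the exponent of the lower bound, psi_1 (A, B) <= H(B) ^ (- b)
    bounds H(B), and only finitely many B remain. *)
Lemma mu_moment_le (R : realType) (d f : nat) (A : {vspace 'cV[R]_(d + f)})
    (kappa : R) : (1 < d)%N -> (d <= f)%N ->
  irrational_space d d.-1 1 A -> 0 < kappa ->
  (forall B, rational_space d.-1 B -> 1 <= height B /\
       forall X Y, X \in A -> X != 0 -> Y \in B -> Y != 0 ->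
       kappa <= psi X Y ^+ f.+1 * height B ^+ (d * (d + f))) ->
  (mu A d.-1 1 <= ((d * (d + f))%:R / f.+1%:R : R)%:E)%E.
Proof.
move=> d1 df [dimA _] kappa0 Hpsi.
apply: ge_ereal_sup => _ [b [b0 infB] <-]; rewrite lee_fin leNgt.
apply/negP => lt_b; apply: infB.
set D := (d * (d + f))%N in Hpsi lt_b.
pose eps : R := b * f.+1%:R - D%:R.
have eps0 : 0 < eps by rewrite subr_gt0 -ltr_pdivrMr ?ltr0n.
apply: (@sub_finite_set _ _ _ _ (@finite_bounded_height R (d + f) d.-1
  (kappa^-1 `^ eps^-1))).
move=> B [ratB le_psi]; split=> //.
have [ht1 HB] := Hpsi B ratB.
have ht0 : 0 < height B by apply: lt_le_trans ht1.
have dimB : \dim B = d.-1 by case: ratB => t /size_basis.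
have A0 : A != 0%VS by rewrite -dimv_eq0 dimA -lt0n ltnW.
have B0 : B != 0%VS by rewrite -dimv_eq0 dimB -lt0n -subn1 subn_gt0.
pose r := (kappa / height B ^+ D) `^ (f.+1%:R^-1).
have kh0 : 0 <= kappa / height B ^+ D.
  by rewrite divr_ge0 ?exprn_ge0 // ltW.
have le_r : r <= psi_space A B 1.
  apply: psi_space_ge => // X Y XA X0 YB Y0.
  apply: powR_root => //; first exact: psi_ge0.
  by rewrite ler_pdivrMr ?exprn_gt0 // HB.
have le_kappa : kappa <= height B `^ (- eps).
  have := le_trans le_r le_psi.
  move=> /(ge0_ler_powR (ler0n R f.+1)).
  rewrite !nnegrE !powR_ge0 => /(_ isT isT).
  rewrite /r -!powRrM mulVf ?pnatr_eq0 // powRr1 // ler_pdivrMr ?exprn_gt0 //.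
  move=> /le_trans; apply; rewrite -powR_mulrn ?(ltW ht0) // -powRD; last first.
    by apply/implyP => _; rewrite gt_eqF.
  by rewrite /eps opprB mulNr addrC.
have le_eps : height B `^ eps <= kappa^-1.
  rewrite -[leLHS]invrK lef_pV2 ?posrE ?invr_gt0 ?powR_gt0 //.
  by rewrite -powRN.
have -> : height B = (height B `^ eps) `^ eps^-1.
  by rewrite -powRrM mulfV ?gt_eqF // powRr1 // ltW.
by apply: ge0_ler_powR; rewrite ?nnegrE ?powR_ge0 ?invr_ge0 // ltW.
Qed.

Theorem proposition5p9 (R : realType) (n d : nat)
    (hn : (6 <= n)%N) (hd : (3 <= d <= n./2)%N) :
  (mu_inf R n d d.-1 1 <= ((2 * d%:R ^+ 2) / (d%:R + 1) : R)%:E)%E.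
Proof.
have [f df ->] : exists2 f, (d <= f)%N & n = (d + f)%N.
  by exists (n - d)%N; lia.
have d1 : (1 < d)%N by lia.
have [A [irrA [kappa kappa0 Hpsi]]] := @moment_space_psi_bound R d f d1 df.
apply: (@le_trans _ _ (mu A d.-1 1)).
  by apply: ereal_inf_lbound; exists A.
apply: le_trans (mu_moment_le d1 df irrA kappa0 Hpsi) _.
by rewrite lee_fin exponent_le.
Qed.
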